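(* Let $(\mathcal{A},\varphi)$ be a Banach non-commutative probability space and let $(a_1,b_1)$ and $(a_2,b_2)$ be two pairs of elements of $\mathcal{A}$ that are bi-free with respect to $\varphi$ and satisfy $\varphi(a_k)\neq 0$ and $\varphi(b_k)\neq 0$ for $k=1,2$. Then $$S^{\mathrm{op}}_{a_1a_2,\,b_2b_1}(z,w)=S^{\mathrm{op}}_{a_1,b_1}(z,w)\,S^{\mathrm{op}}_{a_2,b_2}(z,w)$$ for all $(z,w)\in(\mathbb{C}\setminus\{0\})^2$ sufficiently near $(0,0)$.
   Context: A Banach non-commutative probability space $(\mathcal{A},\varphi)$ is a unital complex Banach algebra $\mathcal{A}$ with a continuous linear functional $\varphi:\mathcal{A}\to\mathbb{C}$ with $\varphi(1)=1$. Opposite bi-free partial $S$-transform. For $a\in\mathcal{A}$ with $\varphi(a)\ne0$ let $h_a(z)=\sum_{n\ge0}\varphi(a^n)z^n$ (for small $z$), $\psi_a(z)=h_a(z)-1$, and let $\mathcal{X}_a=\psi_a^{\langle -1\rangle}$ be the inverse of $\psi_a$ under composition near $0$ (it exists since $\psi_a(0)=0$, $\psi_a'(0)=\varphi(a)\neq0$). For $a,b\in\mathcal{A}$ let $H_{a,b}(z,w)=\sum_{n,m\ge0}\varphi(a^nb^m)z^nw^m$ (for small $z,w$). If $\varphi(a)\ne0\ne\varphi(b)$, define for $(z,w)\in(\mathbb{C}\setminus\{0\})^2$ near $(0,0)$ $$S^{\mathrm{op}}_{a,b}(z,w)=\frac{w(z+1)}{z(w+1)}\cdot\frac{H_{a,b}(\mathcal{X}_a(z),\mathcal{X}_b(w))-(w+1)}{H_{a,b}(\mathcal{X}_a(z),\mathcal{X}_b(w))-(z+1)}.$$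 (Bi-freeness implies that $a_1,a_2$ are free and $b_1,b_2$ are free, so $\varphi(a_1a_2)=\varphi(a_1)\varphi(a_2)\neq0$ and $\varphi(b_2b_1)\neq0$.) Bi-free cumulants and bi-freeness. For $\chi:\{1,\dots,n\}\to\{\ell,r\}$ with $\chi^{-1}(\ell)=\{k_1<\dots<k_j\}$ and $\chi^{-1}(r)=\{k_{j+1}>\dots>k_n\}$, let $s_\chi(i)=k_i$. $BNC(\chi)$ is the set of partitions $\pi$ of $\{1,\dots,n\}$ such that $s_\chi^{-1}\cdot\pi$ (apply $s_\chi^{-1}$ to every element of every block) is non-crossing. The $(\ell,r)$-cumulants $\kappa_\chi:\mathcal{A}^n\to\mathbb{C}$ are the multilinear maps determined recursively by $\varphi(c_1\cdots c_n)=\sum_{\pi\in BNC(\chi)}\kappa_\pi(c_1,\dots,c_n)$ for all $\chi$ and $c_i$, where $\kappa_\pi(c_1,\dots,c_n)=\prod_{V\in\pi}\kappa_{\chi|_V}((c_i)_{i\in V})$, with the order on $V$ induced from $\{1,\dots,n\}$. Pairs $(a_1,b_1)$, $(a_2,b_2)$ (left variables $a_k$, right variables $b_k$) are bi-free with respect to $\varphi$ if all mixed cumulants vanish: for all $n\geq 2$, all $\chi:\{1,\dots,n\}\to\{\ell,r\}$ and all non-constant $\epsilon:\{1,\dots,n\}\to\{1,2\}$, $\kappa_\chi(c_1,\dots,c_n)=0$ where $c_i=a_{\epsilon(i)}$ if $\chi(i)=\ell$ and $c_i=b_{\epsilon(i)}$ if $\chi(i)=r$. (This is equivalent to Voiculescu's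 original definition of bi-freeness.) *)

(* Defs.v *)
From HB Require Import structures.
From mathcomp Require Import all_boot all_order all_algebra all_fingroup.

Set Implicit Arguments.
Unset Strict Implicit.
Unset Printing Implicit Defensive.

(* For chi : 'I_n -> bool, chi i = true means chi(i) = l (left), and
   chi i = false means chi(i) = r (right). *)

Definition schi_seq n (chi : 'I_n -> bool) : seq 'I_n :=
  [seq i <- enum 'I_n | chi i] ++ rev [seq i <- enum 'I_n | ~~ chi i].

Lemma schi_seq_uniq n (chi : 'I_n -> bool) : uniq (schi_seq chi).
Proof.
rewrite cat_uniq rev_uniq !filter_uniq -?enumT ?enum_uniq// andbT andTb.
by apply/hasPn => i; rewrite mem_rev !mem_filter => /andP[/negbTE->].
Qed.

Lemma size_schi_seq n (chi : 'I_n -> bool) : size (schi_seq chi) = n.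
Proof.
by rewrite size_cat size_rev !size_filter count_predC size_enum_ord.
Qed.

Lemma schi_inj n (chi : 'I_n -> bool) :
  injective (fun i : 'I_n => nth i (schi_seq chi) i).
Proof.
move=> i j /=; rewrite (set_nth_default j) ?size_schi_seq// => /eqP.
by rewrite nth_uniq ?size_schi_seq ?schi_seq_uniq// => /eqP/val_inj.
Qed.

(* s_chi(i) = k_i: the left positions in increasing order, followed by the
   right positions in decreasing order. *)
Definition schi n (chi : 'I_n -> bool) : {perm 'I_n} := perm (@schi_inj n chi).

Definition noncrossing n (P : {set {set 'I_n}}) : bool :=
  [forall V in P, forall W in P, (V != W) ==>
    [forall i in V, forall j in W, forall k in V, forall l in W,
      ~~ [&& i < j, j < k & k < l]]].

Definition BNC n (chi : 'I_n -> bool) : {set {set {set 'I_n}}} :=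
  [set P | partition P [set: 'I_n] &
           noncrossing [set [set ((schi chi)^-1)%g i | i in V] | V : {set 'I_n} in P]].

Definition one_block n : {set {set 'I_n}} := [set [set: 'I_n]].

Lemma block_gt0 n (chi : 'I_n -> bool) (P : {set {set 'I_n}}) (V : {set 'I_n}) :
  P \in BNC chi -> V \in P -> 0 < #|V|.
Proof.
rewrite inE => /andP[/and3P[_ _ P0] _] VP; rewrite card_gt0.
by apply: contra P0 => /eqP <-.
Qed.

Lemma block_lt n (chi : 'I_n -> bool) (P : {set {set 'I_n}}) (V : {set 'I_n}) :
  P \in BNC chi -> P != one_block n -> V \in P -> #|V| < n.
Proof.
move=> PB PT VP; rewrite -[X in _ < X]card_ord -cardsT proper_card//.
rewrite properT; apply: contra PT => /eqP VT; rewrite VT in VP.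
apply/eqP/setP => W; rewrite inE; apply/idP/eqP => [WP|->//].
have /trivIsetP tI : trivIset P by move: PB; rewrite inE => /andP[/and3P[]].
apply/eqP; apply: contraT => WT.
have := tI _ _ WP VP WT; rewrite -setI_eq0 setIT => /eqP W0.
by have := block_gt0 PB WP; rewrite W0 cards0.
Qed.

Lemma one_block_BNC n (chi : 'I_n.+1 -> bool) : one_block n.+1 \in BNC chi.
Proof.
rewrite inE; apply/andP; split.
  apply/and3P; split; first by rewrite /cover big_set1.
    by apply/trivIsetP => V W; rewrite !inE => /eqP-> /eqP->; rewrite eqxx.
  by rewrite inE eq_sym -card_gt0 cardsT card_ord.
rewrite imset_set1; apply/forall_inP => V; rewrite inE => /eqP->.
by apply/forall_inP => W; rewrite inE => /eqP->; rewrite eqxx.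
Qed.

(* Imported only now: classical_sets shadows the finset notions used above. *)
From mathcomp Require Import boolp classical_sets reals.
From mathcomp Require Import topology normedtype sequences.
From mathcomp Require Import complex.

Import Order.TTheory GRing.Theory Num.Theory.
Import numFieldNormedType.Exports.

Local Open Scope classical_set_scope.
Local Open Scope ring_scope.

(* Unital Banach algebra over K. The product is a new operation rather than the
   ring product of MathComp, because numDomainType already joins rings and
   normed groups (with the norm valued in the ring itself), which excludes any
   other structure that inherits from both. The unit need not have norm 1. *)
HB.mixin Record CompleteNormedModule_isBanachAlgebra (K : numFieldType) A
    & CompleteNormedModule K A := {
  bone : A ;
  bmul : A -> A -> A ;
  bmulA : associative bmul ;
  bmul1r : left_id bone bmul ;
  bmulr1 : right_id bone bmul ;
  bmulDl : left_distributive bmul +%R ;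
  bmulDr : right_distributive bmul +%R ;
  bscalerAl : forall (k : K) (x y : A), k *: bmul x y = bmul (k *: x) y ;
  bscalerAr : forall (k : K) (x y : A), k *: bmul x y = bmul x (k *: y) ;
  bnormM : forall x y : A, `|bmul x y| <= `|x| * `|y|
}.

#[short(type="banachAlgType")]
HB.structure Definition BanachAlgebra (K : numFieldType) :=
  {A of CompleteNormedModule K A & CompleteNormedModule_isBanachAlgebra K A}.

Arguments bone {K A} : rename.

HB.instance Definition _ (K : numFieldType) (A : banachAlgType K) :=
  Monoid.isLaw.Build A bone (@bmul K A) (@bmulA K A) (@bmul1r K A) (@bmulr1 K A).

Definition bexp (K : numFieldType) (A : banachAlgType K) (a : A) (n : nat) : A :=
  iter n (bmul a) bone.

(* The moment-cumulant formula, solved for the term of the one-block partition.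
   The blocks of the other partitions have fewer than n elements, so the depth
   of the recursion is at most n; d bounds this depth. Since enum_val
   enumerates V in increasing order, composition with it is restriction to V
   with the induced order. *)
Fixpoint cumulant_rec (K : numFieldType) (A : banachAlgType K) (phi : A -> K)
    (d n : nat) (chi : 'I_n -> bool) (c : 'I_n -> A) {struct d} : K :=
  if d is d'.+1 then
    phi (\big[bmul/bone]_(i < n) c i) -
    \sum_(P in BNC chi | P != one_block n)
      \prod_(V in P)
        cumulant_rec phi d' (fun i : 'I_#|V| => chi (enum_val i))
                            (fun i : 'I_#|V| => c (enum_val i))
  else 0.

Definition cumulant (K : numFieldType) (A : banachAlgType K) (phi : A -> K)
    (n : nat) (chi : 'I_n -> bool) (c : 'I_n -> A) : K :=
  cumulant_rec phi n chi c.

Lemma cumulant_rec_indep (K : numFieldType) (A : banachAlgType K)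
    (phi : A -> K) (d d' n : nat) (chi : 'I_n -> bool) (c : 'I_n -> A) :
  (0 < n)%N -> (n <= d)%N -> (n <= d')%N ->
  cumulant_rec phi d chi c = cumulant_rec phi d' chi c.
Proof.
elim: d d' n chi c => [|d IH] [|d'] n chi c n0 nd nd' /=;
  try by move: n0; rewrite ltnNge ?nd ?nd'.
congr (_ - _); apply: eq_bigr => P /andP[PB PT].
apply: eq_bigr => V VP; have Vn := block_lt PB PT VP.
by apply: IH; rewrite ?(block_gt0 PB VP)// -ltnS (leq_trans Vn).
Qed.

Definition cumulant_part (K : numFieldType) (A : banachAlgType K) (phi : A -> K)
    (n : nat) (chi : 'I_n -> bool) (P : {set {set 'I_n}}) (c : 'I_n -> A) : K :=
  \prod_(V in P)
    cumulant phi (fun i : 'I_#|V| => chi (enum_val i))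
                 (fun i : 'I_#|V| => c (enum_val i)).

Lemma cumulant_reindex (K : numFieldType) (A : banachAlgType K) (phi : A -> K)
    (m n : nat) (f : 'I_m -> 'I_n) (chi : 'I_n -> bool) (c : 'I_n -> A) :
  m = n -> (forall i, f i = i :> nat) ->
  cumulant phi (fun i => chi (f i)) (fun i => c (f i)) = cumulant phi chi c.
Proof.
move=> mn; case: n / mn f chi c => f chi c fE.
have fI : f = id.
  by apply/funext => i; apply/val_inj; rewrite /= fE.
by rewrite fI.
Qed.

Lemma moment_cumulant (K : numFieldType) (A : banachAlgType K) (phi : A -> K)
    (n : nat) (chi : 'I_n -> bool) (c : 'I_n -> A) : (0 < n)%N ->
  phi (\big[bmul/bone]_(i < n) c i) =
  \sum_(P in BNC chi) cumulant_part phi chi P c.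
Proof.
case: n chi c => // n chi c _.
rewrite (bigD1 (one_block n.+1)) ?one_block_BNC//=.
rewrite {1}/cumulant_part big_set1 cumulant_reindex ?cardsT ?card_ord//; last first.
  move=> i; rewrite /enum_val (set_nth_default ord0) -?cardE//.
  by rewrite enum_setT -enumT nth_enum_ord// -[X in (_ < X)%N]card_ord -cardsT.
rewrite {1}/cumulant /= -addrA -[LHS]addr0; congr (_ + _); apply/esym/eqP.
rewrite addrC subr_eq0; apply/eqP/eq_bigr => P /andP[PB PT].
apply: eq_bigr => V VP; apply: cumulant_rec_indep => //.
  exact: block_gt0 PB VP.
by rewrite -ltnS (block_lt PB PT VP).
Qed.

(* eps i = false stands for the pair (a1, b1), eps i = true for (a2, b2). *)
Definition bifree (K : numFieldType) (A : banachAlgType K) (phi : A -> K)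
    (a1 b1 a2 b2 : A) : Prop :=
  forall (n : nat) (chi eps : 'I_n -> bool),
    (2 <= n)%N -> (exists i j, eps i != eps j) ->
    cumulant phi chi
      (fun i => if chi i then (if eps i then a2 else a1)
                         else (if eps i then b2 else b1)) = 0.

Definition h_fun (K : numFieldType) (A : banachAlgType K) (phi : A -> K)
    (a : A) (z : K) : K :=
  limn [series phi (bexp a n) * z ^+ n]_n.

Definition psi_fun (K : numFieldType) (A : banachAlgType K) (phi : A -> K)
    (a : A) (z : K) : K :=
  h_fun phi a z - 1.

(* For small z, w the double series converges absolutely, hence its sum is the
   iterated sum. *)
Definition H_fun (K : numFieldType) (A : banachAlgType K) (phi : A -> K)
    (a b : A) (z w : K) : K :=
  limn [series limn [series
    phi (bmul (bexp a n) (bexp b m)) * z ^+ n * w ^+ m]_m]_n.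

(* If f is analytic near 0 with f 0 = 0 and f' 0 != 0, then such a g exists and
   any two of them coincide near 0. *)
Definition is_compinv (K : numFieldType) (f g : K -> K) : Prop :=
  (\forall z \near (0 : K), g (f z) = z) /\
  (\forall w \near (0 : K), f (g w) = w).

Definition compinv (K : numFieldType) (f : K -> K) : K -> K :=
  xget (fun=> 0) [set g | is_compinv f g].

Definition X_fun (K : numFieldType) (A : banachAlgType K) (phi : A -> K)
    (a : A) : K -> K :=
  compinv (psi_fun phi a).

Definition Sop (K : numFieldType) (A : banachAlgType K) (phi : A -> K)
    (a b : A) (z w : K) : K :=
  let H := H_fun phi a b (X_fun phi a z) (X_fun phi b w) in
  (w * (z + 1)) / (z * (w + 1)) * ((H - (w + 1)) / (H - (z + 1))).

(* Main.v *)
(* Haagerup's proof of the multiplicativity of the S-transform, carried over to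
   pairs. Put alpha = 1 + z, beta = 1 + w and let u, v be the resolvents
   (1 - X_{a1}(z) a1)^-1 and (1 - X_{a2}(z) a2)^-1, so that phi u = phi v = alpha.
   With u0 = u - alpha, v0 = v - alpha, zeta = 1 / (z alpha) and
   s = X_{a1}(z) X_{a2}(z) alpha / z one has
     u (1 - s a1 a2) v = alpha (1 - zeta u0 v0),
   hence (1 - s a1 a2)^-1 = v (1 - zeta u0 v0)^-1 u / alpha; the value of phi on
   it is alpha, so s = X_{a1 a2}(z). The same holds on the right for (b2, b1).
   Thus H_{a1a2,b2b1} is a sum of moments phi (x_1 ... x_k y_l ... y_1) of
   alternating centered elements, and bi-freeness gives
     phi (X x Y y) = phi (x y) phi (X Y)
   when x, y have one colour and X, Y are alternating centered words ending in
   the other. The geometric series that remain yield, with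
   p = H_{a1,b1} - alpha beta and q = H_{a2,b2} - alpha beta,
     H_{a1a2,b2b1} - alpha beta =
       (p + q + p q (1/(z beta) + 1/(w alpha))) / (1 - p q / (z w alpha beta)),
   while S^op = (1 + p/(z beta)) / (1 + p/(w alpha)); multiplicativity follows.

   The moment formula comes from the moment-cumulant formula: a noncrossing
   partition with monochromatic blocks, on a word cut into intervals of
   alternating colours, always has an interval that is a union of blocks. *)
Require Import Defs.
From mathcomp Require Import all_boot all_order all_algebra all_fingroup.
From mathcomp Require Import zify.

Set Implicit Arguments.
Unset Strict Implicit.
Unset Printing Implicit Defensive.

Import GRing.Theory.

(** * Noncrossing partitions *)

Lemma partitionE (T : finType) (P : {set {set T}}) (D : {set T}) :
  reflect [/\ forall V, V \in P -> V \subset D /\ V != set0,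
              forall x, x \in D -> exists2 V, V \in P & x \in V
            & forall V W x, V \in P -> W \in P -> x \in V -> x \in W -> V = W]
          (partition P D).
Proof.
apply: (iffP idP) => [pP|[P1 P2 P3]].
  have [/eqP cP tP P0] := and3P pP; split=> [V VP|x|V W x VP WP xV xW].
  - split; first by rewrite -cP; apply: bigcup_sup.
    by apply: contraNneq P0 => <-.
  - by rewrite -cP => /bigcupP[V VP xV]; exists V.
  - by rewrite -(def_pblock tP VP xV) (def_pblock tP WP xW).
apply/and3P; split.
- rewrite eqEsubset; apply/andP; split; first by apply/bigcupsP => V /P1[].
  by apply/subsetP => x /P2[V VP xV]; apply/bigcupP; exists V.
- apply/trivIsetP => V W VP WP VW; rewrite -setI_eq0; apply/eqP/setP => x.
  rewrite !inE; apply: contraNF VW => /andP[xV xW].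
  by rewrite (P3 V W x).
- by apply/negP => /P1[]; rewrite eqxx.
Qed.

Section NoncrossingPartitions.
Variables (T : finType) (rk : T -> nat).
Implicit Types (P Q : {set {set T}}) (D V W : {set T}) (x y : T).

(** Crossings are measured by an arbitrary rank: with [chi_rank] this expresses membership in [BNC]
    without moving the blocks by a permutation. *)
Definition ncr P : bool :=
  [forall V in P, forall W in P, (V != W) ==>
    [forall i in V, forall j in W, forall k in V, forall l in W,
      ~~ [&& rk i < rk j, rk j < rk k & rk k < rk l]]].

Lemma ncrP P :
  reflect (forall V W i j k l, V \in P -> W \in P -> V != W ->
             i \in V -> j \in W -> k \in V -> l \in W ->
             rk i < rk j -> rk j < rk k -> rk k < rk l -> False) (ncr P).
Proof.
apply: (iffP idP) => [H V W i j k l VP WP VW iV jW kV lW ij jk kl|H].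
  move: H => /forall_inP/(_ V VP)/forall_inP/(_ W WP)/implyP/(_ VW).
  move=> /forall_inP/(_ i iV)/forall_inP/(_ j jW)/forall_inP/(_ k kV).
  by move=> /forall_inP/(_ l lW); rewrite ij jk kl.
apply/forall_inP => V VP; apply/forall_inP => W WP; apply/implyP => VW.
apply/forall_inP => i iV; apply/forall_inP => j jW; apply/forall_inP => k kV.
apply/forall_inP => l lW; apply/and3P => -[ij jk kl].
exact: (H V W i j k l).
Qed.

Lemma ncr_sub P Q : Q \subset P -> ncr P -> ncr Q.
Proof.
move=> /subsetP QP /ncrP H; apply/ncrP => V W i j k l VQ WQ.
by apply: H; apply: QP.
Qed.

Definition NC D : {set {set {set T}}} := [set P | partition P D & ncr P].

(* An interval decomposition of [T] is encoded by the index [lab x] of the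
   interval of [x]. *)
Variable lab : T -> nat.
Hypothesis lab_rk : forall x y, lab x < lab y -> rk x < rk y.

Definition ivl j : {set T} := [set x | lab x == j].

(** For a partition of [D] this says that [D :&: ivl j] is a union of blocks. *)
Definition sat P j : bool := [forall V in P, (V \subset ivl j) || [disjoint V & ivl j]].

Definition inner P j := [set V in P | V \subset ivl j].
Definition outer P j := [set V in P | [disjoint V & ivl j]].

Lemma between_ivl x y z : lab x = lab z -> rk x < rk y -> rk y < rk z -> lab y = lab x.
Proof.
move=> xz xy yz; case: (ltngtP (lab y) (lab x)) => // /[dup] h; last rewrite xz.
  by move=> /lab_rk/ltnW; rewrite leqNgt xy.
by move=> /lab_rk/ltnW; rewrite leqNgt yz.
Qed.

Lemma not_sub_disjoint V j : V != set0 -> V \subset ivl j -> [disjoint V & ivl j] = false.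
Proof.
move=> /set0Pn[x xV] /subsetP VI; apply/negP => /disjointFr/(_ xV).
by rewrite (VI _ xV).
Qed.

(** Two crossing blocks each have a point between two points of the other. If one lies in the
    interval and the other outside, convexity of the interval ([between_ivl]) excludes this. With
    [NC_split] one gets a bijection between the pairs [(P, Q)] and the partitions that saturate
    [j]. *)
Lemma NC_union D j P Q : P \in NC (D :&: ivl j) -> Q \in NC (D :\: ivl j) ->
  [/\ P :|: Q \in NC D, sat (P :|: Q) j, inner (P :|: Q) j = P & outer (P :|: Q) j = Q].
Proof.
rewrite !inE => /andP[/partitionE[P1 P2 P3] /ncrP Pn].
move=> /andP[/partitionE[Q1 Q2 Q3] /ncrP Qn].
have PI V : V \in P -> V \subset ivl j by move=> /P1[/subsetIP[]].
have QI V : V \in Q -> [disjoint V & ivl j].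
  by move=> /Q1[]; rewrite subsetD => /andP[].
have labP V x : V \in P -> x \in V -> lab x = j.
  by move=> /PI/subsetP VI /VI; rewrite inE => /eqP.
have labQ V x : V \in Q -> x \in V -> lab x <> j.
  by move=> /QI VI /(disjointFr VI); rewrite inE => /eqP.
split.
- apply/andP; split.
    apply/partitionE; split.
    + move=> V /setUP[/P1|/Q1] [VD V0]; split=> //.
        by move: VD => /subsetIP[].
      by move: VD; rewrite subsetD => /andP[].
    + move=> x xD; case xI: (x \in ivl j).
        have [|V VP xV] := P2 x; first by rewrite inE xD.
        by exists V => //; rewrite inE VP.
      have [|V VQ xV] := Q2 x; first by rewrite inE xD xI.
      by exists V => //; rewrite inE VQ orbT.
    + move=> V W x /setUP[VP|VQ] /setUP[WP|WQ] xV xW.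
      * exact: (P3 V W x).
      * by have := labQ _ _ WQ xW; rewrite (labP _ _ VP xV).
      * by have := labQ _ _ VQ xV; rewrite (labP _ _ WP xW).
      * exact: (Q3 V W x).
  apply/ncrP => V W i k i' k' /setUP[VP|VQ] /setUP[WP|WQ] VW iV kW i'V k'W h1 h2 h3.
  + exact: (Pn V W i k i' k').
  + apply: (labQ _ _ WQ kW); rewrite -(labP _ _ VP iV).
    by apply: (between_ivl _ h1 h2); rewrite !(labP V).
  + apply: (labQ _ _ VQ i'V); rewrite -(labP _ _ WP kW).
    by apply: (between_ivl _ h2 h3); rewrite !(labP W).
  + exact: (Qn V W i k i' k').
- by apply/forall_inP => V /setUP[/PI->//|/QI->]; rewrite orbT.
- apply/setP => V; rewrite !inE; apply/idP/idP => [/andP[/orP[//|VQ] VI]|VP].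
    by have := not_sub_disjoint (Q1 _ VQ).2 VI; rewrite QI.
  by rewrite VP PI.
- apply/setP => V; rewrite !inE; apply/idP/idP => [/andP[/orP[VP|//] VI]|VQ].
    by have := not_sub_disjoint (P1 _ VP).2 (PI _ VP); rewrite VI.
  by rewrite VQ orbT QI.
Qed.

Lemma NC_split D j P : P \in NC D -> sat P j ->
  [/\ inner P j \in NC (D :&: ivl j), outer P j \in NC (D :\: ivl j)
    & inner P j :|: outer P j = P].
Proof.
rewrite !inE => /andP[/partitionE[P1 P2 P3] Pn] /forall_inP Ps.
have iP : inner P j \subset P by apply/subsetP => V; rewrite inE => /andP[].
have oP : outer P j \subset P by apply/subsetP => V; rewrite inE => /andP[].
split.
- rewrite (ncr_sub iP Pn) andbT; apply/partitionE; split.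
  + move=> V; rewrite inE => /andP[VP VI]; have [VD V0] := P1 V VP.
    by rewrite subsetI VD VI.
  + move=> x; rewrite inE => /andP[/P2[V VP xV] xI]; exists V => //.
    rewrite inE VP; case/orP: (Ps V VP) => // /disjointFr/(_ xV).
    by rewrite xI.
  + by move=> V W x /(subsetP iP) VP /(subsetP iP) WP; apply: P3.
- rewrite (ncr_sub oP Pn) andbT; apply/partitionE; split.
  + move=> V; rewrite inE => /andP[VP VI]; have [VD V0] := P1 V VP.
    by rewrite subsetD VD VI.
  + move=> x; rewrite inE => /andP[xI /P2[V VP xV]]; exists V => //.
    rewrite inE VP; case/orP: (Ps V VP) => // /subsetP/(_ _ xV).
    by rewrite (negbTE xI).
  + by move=> V W x /(subsetP oP) VP /(subsetP oP) WP; apply: P3.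
- apply/setP => V; rewrite !inE -andb_orr; apply/idP/idP => [/andP[]//|VP].
  by rewrite VP Ps.
Qed.

Lemma sat_union D j P Q j' : P \in NC (D :&: ivl j) -> j' != j ->
  sat (P :|: Q) j' = sat Q j'.
Proof.
rewrite inE => /andP[/partitionE[P1 _ _] _] jj.
apply/forall_inP/forall_inP => H V VP; first by apply: H; rewrite inE VP orbT.
move: VP => /setUP[/P1[/subsetIP[_ /subsetP VI] _]|/H//].
apply/orP; right; apply/pred0P => x /=; apply/negP => /andP[/VI].
by rewrite !inE => /eqP->; rewrite eq_sym (negbTE jj).
Qed.

Section Weights.
Variables (K : comNzRingType) (kap : {set T} -> K).
Local Open Scope ring_scope.

Definition wsum D : K := \sum_(P in NC D) \prod_(V in P) kap V.

Definition unsat_sum (js : seq nat) D : K :=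
  \sum_(P in NC D | all (fun j => ~~ sat P j) js) \prod_(V in P) kap V.

(** The bijection [P <-> (inner P j, outer P j)] splits the product of the weights, and by
    [sat_union] the intervals of [js] see only the outer part. *)
Lemma sat_sum js D j : j \notin js ->
  \sum_(P in NC D | sat P j && all (fun j => ~~ sat P j) js) \prod_(V in P) kap V =
  wsum (D :&: ivl j) * unsat_sum js (D :\: ivl j).
Proof.
move=> jjs; rewrite /wsum /unsat_sum big_distrlr /= pair_big /=.
rewrite (reindex_onto (fun p => p.1 :|: p.2) (fun P => (inner P j, outer P j))) /=.
  have unsat P Q : P \in NC (D :&: ivl j) ->
      all (fun i => ~~ sat (P :|: Q) i) js = all (fun i => ~~ sat Q i) js.
    move=> PN; apply: eq_in_all => i ijs; rewrite (sat_union _ PN) //.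
    by apply: contraNneq jjs => <-.
  apply: eq_big => [[P Q] /=|[P Q] /=].
    apply/idP/idP => [/andP[/and3P[PN Ps Pu] /eqP[PE QE]]|/and3P[PN QN Pu]].
      have [iN oN _] := NC_split PN Ps.
      by rewrite PE QE in iN oN; rewrite iN oN -(unsat P).
    have [UN -> -> ->] := NC_union PN QN.
    by rewrite UN unsat // Pu eqxx.
  move=> /andP[/and3P[PN Ps Pu] /eqP[PE QE]].
  have [iN oN _] := NC_split PN Ps; rewrite PE QE in iN oN.
  have PQ : [disjoint P & Q].
    rewrite -setI_eq0; apply/eqP/setP => V; rewrite !inE; apply/negP => /andP[VP VQ].
    move: iN oN; rewrite !inE => /andP[/partitionE[/(_ V VP)[VI V0] _ _] _].
    move=> /andP[/partitionE[/(_ V VQ)[]]]; rewrite subsetD => /andP[_].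
    by rewrite not_sub_disjoint //; move: VI => /subsetIP[].
  by rewrite (eq_bigl [predU P & Q]) ?bigU //= => V; rewrite !inE.
by move=> P /and3P[PN Ps _]; have [_ _] := NC_split PN Ps.
Qed.

(** One step of inclusion-exclusion over saturated intervals; [centered_moment] below obeys the same
    recursion. *)
Lemma unsat_sum_cons js D j : j \notin js ->
  unsat_sum (j :: js) D =
  unsat_sum js D - wsum (D :&: ivl j) * unsat_sum js (D :\: ivl j).
Proof.
move=> jjs; rewrite -sat_sum // /unsat_sum; apply/eqP; rewrite eq_sym subr_eq; apply/eqP.
rewrite (bigID (sat^~ j)) addrC /=.
by congr (_ + _); apply: eq_bigl => P; rewrite -andbA; congr (_ && _); rewrite andbC.
Qed.

Variables (eps : T -> bool) (e0 : bool).
Hypothesis eps_lab : forall x, eps x = e0 (+) odd (lab x).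

(* Take a block meeting two intervals at minimal distance d. Then d >= 2, and
   the interval next to the first one is not saturated, so a second block leaves
   it: by noncrossingness that block meets two intervals at distance < d. *)
Lemma exists_sat P D k : P \in NC D -> (forall x, lab x < k)%N -> (0 < k)%N ->
  (forall V x y, V \in P -> x \in V -> y \in V -> eps x = eps y) ->
  (forall j, (j < k)%N -> ~~ sat P j) -> False.
Proof.
rewrite inE => /andP[_ /ncrP Pn] labk k0 Peps Pu.
have neighbour j : (j < k)%N -> exists V x y,
    [/\ V \in P, x \in V, y \in V, lab x = j & lab y <> j].
  move=> /Pu; rewrite negb_forall => /existsP[V]; rewrite negb_imply negb_or.
  move=> /and3P[VP /subsetPn[y yV yI] /pred0Pn[x /andP[xV xI]]].
  by exists V, x, y; rewrite !inE in xI yI; split=> //; apply/eqP.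
have gap d V x y : V \in P -> x \in V -> y \in V -> lab y = (lab x + d.+1)%N -> False.
  elim/ltn_ind: d V x y => d IH V x y VP xV yV xyd.
  have d0 : (0 < d)%N.
    case: d {IH} xyd => // xyd; have := Peps V x y VP xV yV.
    by rewrite !eps_lab xyd addn1 oddS; case: (odd _); case: e0.
  have [|W [u [t [WP uW tW labu labt]]]] := neighbour (lab x).+1.
    by apply: leq_ltn_trans (labk y); rewrite xyd; lia.
  have [WV|/eqP WV] := eqVneq W V.
    by apply: (IH 0%N d0 V x u VP xV); rewrite -?WV // labu addn1.
  (* The interval of [t] decides: before that of [x], the points [t, x, u, y] cross; after that of
     [y], the points [x, u, y, t] cross; otherwise [u] and [t] are at a smaller distance in [W]. *)
  have [tx|tx] := ltnP (lab t) (lab x).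
    apply: (Pn W V t x u y) => //; first exact/eqP; apply: lab_rk; rewrite ?labu ?xyd //.
    by lia.
  have [ty|ty] := ltnP (lab y) (lab t).
    apply: (Pn V W x u y t) => //; try exact: lab_rk.
    - by apply/eqP => /esym.
    - by apply: lab_rk; rewrite labu.
    - by apply: lab_rk; rewrite labu xyd; lia.
  have [tu|tu] := ltnP (lab t) (lab u).
    by apply: (IH 0%N d0 W t u) => //; lia.
  apply: (IH (lab t - lab u).-1 _ W u t) => //; lia.
have [V [x [y [VP xV yV labx laby]]]] := neighbour 0%N k0.
by apply: (gap (lab y).-1 V x y) => //; lia.
Qed.

Hypothesis kap_mixed :
  forall V x y, x \in V -> y \in V -> eps x != eps y -> kap V = 0.

(** A partition with a two-coloured block has weight 0; any other saturates some interval by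
    [exists_sat], and [js] lists all of them. *)
Lemma unsat_sum0 js D k : (forall x, lab x < k)%N -> (0 < k)%N ->
  (forall j, j < k -> j \in js)%N -> unsat_sum js D = 0.
Proof.
move=> labk k0 jsk; apply: big1 => P /andP[PN /allP Pu].
have [/existsP[V /andP[VP /existsP[x /existsP[y /and3P[xV yV xy]]]]]|H] :=
  boolP [exists V in P, [exists x, exists y, [&& x \in V, y \in V & eps x != eps y]]].
  by rewrite (bigD1 V) //= (kap_mixed xV yV xy) mul0r.
exfalso; apply: (@exists_sat P D k) => // [V x y VP xV yV|j jk]; last exact/Pu/jsk.
apply/eqP; apply: contraNT H => xy; apply/existsP; exists V; rewrite VP.
by apply/existsP; exists x; apply/existsP; exists y; rewrite xV yV.
Qed.

End Weights.
End NoncrossingPartitions.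

(** * Order of the positions, its restriction to subsets, transport of partitions *)

Lemma pairwise_enum n (D : {pred 'I_n}) : pairwise (fun i j : 'I_n => i < j) (enum D).
Proof.
suff H : pairwise (fun i j : 'I_n => i < j) (enum 'I_n).
  by rewrite /enum_mem; apply: pairwise_filter; rewrite -enumT.
rewrite -sorted_pairwise; last by move=> a b c; apply: ltn_trans.
by have := iota_ltn_sorted 0 n; rewrite -val_enum_ord sorted_map.
Qed.

Lemma enum_val_mono n (D : {pred 'I_n}) (i j : 'I_#|D|) :
  (enum_val i < enum_val j) = (i < j).
Proof.
have mono (k l : 'I_#|D|) : k < l -> enum_val k < enum_val l.
  move=> kl; have /pairwiseP H := pairwise_enum D.
  have := H (enum_val k) k l; rewrite !inE -!cardE !ltn_ord => /(_ isT isT kl).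
  by rewrite -!enum_val_nth.
apply/idP/idP => [|/mono//]; apply: contraTT; rewrite -!leqNgt.
by rewrite leq_eqVlt => /orP[/eqP/val_inj->//|/mono/ltnW].
Qed.

Section ChiOrder.
Variables (n : nat) (chi : 'I_n -> bool).

(** The order in which [schi chi] lists the positions, written through [chi] and [<] alone, so that
    it is visibly inherited by subsets. *)
Definition chi_lt (x y : 'I_n) : bool :=
  if chi x then chi y ==> (x < y) else ~~ chi y && (y < x).

Definition chi_rank (x : 'I_n) : nat := ((schi chi)^-1)%g x.

Lemma mem_schi_seq x : x \in schi_seq chi.
Proof.
by rewrite mem_cat mem_rev (mem_filter chi) (mem_filter (fun i => ~~ chi i)) mem_enum !andbT orbN.
Qed.

Lemma chi_rankE x : chi_rank x = index x (schi_seq chi).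
Proof.
have xn : index x (schi_seq chi) < n.
  by rewrite -[X in _ < X](size_schi_seq chi) index_mem mem_schi_seq.
suff xE : schi chi (Ordinal xn) = x by rewrite /chi_rank -[in LHS]xE permK.
by rewrite permE /= (set_nth_default x) ?nth_index ?mem_schi_seq ?size_schi_seq.
Qed.

Lemma chi_rank_lt x y : (chi_rank x < chi_rank y) = chi_lt x y.
Proof.
have lt_trans : transitive chi_lt.
  move=> b a c; rewrite /chi_lt.
  by case: (chi a) (chi b) (chi c) => [] [] [] //=; lia.
have sorted_enum := pairwise_enum [pred i : 'I_n | true].
have lt_sorted : sorted chi_lt (schi_seq chi).
  apply: pairwise_sorted; rewrite pairwise_cat; apply/and3P; split.
  - apply/allrelP => a b; rewrite mem_rev (mem_filter chi) (mem_filter (fun i => ~~ chi i)).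
    move=> /andP[ca _] /andP[cb _].
    by rewrite /chi_lt ca (negbTE cb).
  - apply: (sub_in_pairwise (P := chi) _ (filter_all _ _) (pairwise_filter _ sorted_enum)).
    by move=> a b; rewrite !unfold_in /chi_lt => -> ->.
  - rewrite -sorted_pairwise // rev_sorted; apply: pairwise_sorted.
    apply: (sub_in_pairwise (P := predC chi) _ (filter_all _ _) (pairwise_filter _ sorted_enum)).
    by move=> a b /negbTE ca /negbTE cb; rewrite /chi_lt ca cb.
rewrite !chi_rankE; apply/idP/idP => [|xy].
  by apply: sorted_ltn_index => //; apply: mem_schi_seq.
rewrite ltnNge leq_eqVlt; apply/negP => /orP[/eqP/index_inj|].
  move=> /(_ x (mem_schi_seq _) (mem_schi_seq _)) yx; move: xy; rewrite yx /chi_lt.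
  by rewrite ltnn; case: (chi x).
move=> /(sorted_ltn_index lt_trans lt_sorted _ _ (mem_schi_seq _) (mem_schi_seq _)).
move=> /(lt_trans _ _ _ xy); rewrite /chi_lt.
by rewrite ltnn; case: (chi x).
Qed.

End ChiOrder.

Section ImsetPartition.
Variables (S T : finType) (f : S -> T).
Hypothesis f_inj : injective f.
Implicit Types (P : {set {set S}}) (V : {set S}).

Definition imset2 P : {set {set T}} := [set f @: V | V : {set S} in P].

Lemma imset2_partition P (D : {set S}) : partition (imset2 P) (f @: D) = partition P D.
Proof.
apply/partitionE/partitionE => -[P1 P2 P3]; split.
- move=> V VP; have [VD V0] := P1 _ (imset_f (fun V : {set S} => f @: V) VP); split.
    by apply/subsetP => x xV; move/subsetP: VD => /(_ _ (imset_f f xV)); rewrite mem_imset.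
  by apply: contraNneq V0 => ->; rewrite imset0.
- move=> x xD; have [_ /imsetP[V VP ->]] := P2 _ (imset_f f xD).
  by rewrite mem_imset // => xV; exists V.
- move=> V W x VP WP xV xW; apply: (imset_inj f_inj).
  by apply: (P3 _ _ (f x)); rewrite ?mem_imset //; apply: imset_inj.
- move=> _ /imsetP[V /P1[VD V0] ->]; split; first exact: imsetS.
  by rewrite -card_gt0 card_imset // card_gt0.
- move=> _ /imsetP[x /P2[V VP xV] ->]; exists (f @: V); last exact: imset_f.
  by rewrite mem_imset //; apply: imset_inj.
- move=> _ _ y /imsetP[V VP ->] /imsetP[W WP ->] /imsetP[x xV ->].
  by rewrite mem_imset // => xW; rewrite (P3 V W x).
Qed.

(** Applied to two maps: the inverse of [schi chi], and the increasing inclusion [enum_val] of a set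
    of positions. *)
Lemma imset2_ncr (rkS : S -> nat) (rkT : T -> nat) P :
  (forall x y, (rkT (f x) < rkT (f y)) = (rkS x < rkS y)) ->
  ncr rkT (imset2 P) = ncr rkS P.
Proof.
move=> rkf; apply/ncrP/ncrP.
  move=> H V W i j k l VP WP VW iV jW kV lW ij jk kl.
  apply: (H (f @: V) (f @: W) (f i) (f j) (f k) (f l)); rewrite ?rkf ?mem_imset //.
  - exact: imset_inj.
  - exact: imset_inj.
  - by rewrite (inj_eq (imset_inj f_inj)).
move=> H V' W' i' j' k' l' /imsetP[V VP ->] /imsetP[W WP ->].
rewrite (inj_eq (imset_inj f_inj)) => VW.
move=> /imsetP[i iV ->] /imsetP[j jW ->] /imsetP[k kV ->] /imsetP[l lW ->].
by rewrite !rkf; apply: (H V W).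
Qed.

End ImsetPartition.

Lemma mem_BNC n (chi : 'I_n -> bool) (P : {set {set 'I_n}}) :
  (P \in BNC chi) = (P \in NC (chi_rank chi) [set: 'I_n]).
Proof.
rewrite !inE; congr (_ && _).
by rewrite -[noncrossing _]/(ncr _ _); apply: imset2_ncr => //; apply: perm_inj.
Qed.

Lemma big_enum_val_seq (R : Type) (idx : R) (op : R -> R -> R) (T : finType)
    (D : {set T}) (F : T -> R) :
  \big[op/idx]_(x in D) F x = \big[op/idx]_(i < #|D|) F (enum_val i).
Proof.
have [->|/set0Pn[x0 _]] := eqVneq D set0.
  by rewrite big_set0; apply/esym/big_pred0 => -[i]; rewrite cards0.
rewrite -big_filter -[filter _ _]/(enum D) (big_nth x0) -cardE big_mkord.
by apply: eq_bigr => i _; rewrite -enum_val_nth.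
Qed.

(** * Moments of subwords as sums over noncrossing partitions *)

Section MomentSum.
Local Open Scope ring_scope.
Variables (K : numFieldType) (A : banachAlgType K) (phi : A -> K).
Hypothesis phi1 : phi bone = 1.
Variables (n : nat) (chi : 'I_n -> bool) (c : 'I_n -> A).

Definition kappa (V : {set 'I_n}) : K :=
  cumulant phi (fun i : 'I_#|V| => chi (enum_val i)) (fun i : 'I_#|V| => c (enum_val i)).

(** Both enumerations are strictly increasing lists of the same set. Hence restricting a cumulant to
    [D] and then to [V] is the same as restricting it once to the image of [V]. *)
Lemma enum_val_imset (D : {set 'I_n}) (V : {set 'I_#|D|}) (i : 'I_#|V|)
    (j : 'I_#|[set enum_val x | x in V]|) :
  i = j :> nat -> enum_val j = enum_val (enum_val i) :> 'I_n.
Proof.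
have enumE : enum [set enum_val x | x in V] = [seq enum_val x | x <- enum V].
  apply: (@irr_sorted_eq _ (fun i j : 'I_n => (i < j)%N)).
  - by move=> a b d; apply: ltn_trans.
  - by move=> a; rewrite ltnn.
  - exact/pairwise_sorted/pairwise_enum.
  - rewrite sorted_map (eq_sorted (e' := fun i j : 'I_#|D| => (i < j)%N)).
      exact/pairwise_sorted/pairwise_enum.
    by move=> a b /=; rewrite enum_val_mono.
  - move=> x; rewrite mem_enum; apply/imsetP/mapP => -[y yV ->]; exists y => //.
      by rewrite mem_enum.
    by rewrite -mem_enum.
move=> ij; rewrite (enum_val_nth (enum_val (enum_val i))) enumE -ij.
by rewrite (nth_map (enum_val i)) -?cardE // -enum_val_nth.
Qed.

Lemma kappa_imset (D : {set 'I_n}) (V : {set 'I_#|D|}) :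
  kappa [set enum_val x | x in V] =
  cumulant phi (fun i : 'I_#|V| => chi (enum_val (enum_val i)))
               (fun i : 'I_#|V| => c (enum_val (enum_val i))).
Proof.
have VE : #|[set enum_val x | x in V]| = #|V| by rewrite card_imset //; apply: enum_val_inj.
pose f := cast_ord VE.
rewrite -(@cumulant_reindex _ _ phi _ _ f (fun i => chi (enum_val (enum_val i)))) //.
rewrite /kappa; congr cumulant; apply: boolp.funext => j.
  by rewrite (@enum_val_imset D V (f j)).
by rewrite (@enum_val_imset D V (f j)).
Qed.

Lemma moment_wsum (D : {set 'I_n}) :
  phi (\big[bmul/bone]_(i in D) c i) = wsum (chi_rank chi) kappa D.
Proof.
(* The empty subword is outside the scope of [moment_cumulant]: its moment is [phi bone = 1], and
   its only partition is the empty one, of weight 1. *)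
have [->|D0] := eqVneq D set0.
  rewrite big_set0 phi1 /wsum (bigD1 set0) /=; last first.
    rewrite inE; apply/andP; split; last by apply/ncrP => V W ? ? ? ?; rewrite inE.
    by apply/partitionE; split=> ?; rewrite ?inE.
  rewrite big_set0 big1 ?addr0 // => P /andP[]; rewrite inE => /andP[/partitionE[P1 _ _] _].
  move=> /set0Pn[V VP]; have [] := P1 V VP.
  by rewrite subset0 => ->.
rewrite big_enum_val_seq (moment_cumulant _ (chi \o enum_val)) ?card_gt0 //.
pose e : 'I_#|D| -> 'I_n := enum_val; have e_inj : injective e := enum_val_inj.
have eT : D = e @: [set: 'I_#|D|].
  apply/setP => x; apply/idP/imsetP => [xD|[i _ ->]]; last exact: enum_valP.
  by exists (enum_rank_in xD x); rewrite ?inE // /e enum_rankK_in.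
have preK (V : {set 'I_#|D|}) : e @^-1: (e @: V) = V.
  by apply/setP => i; rewrite inE mem_imset.
pose pre (Q : {set {set 'I_n}}) := [set e @^-1: V | V : {set 'I_n} in Q].
have preQ P : pre (imset2 e P) = P.
  by rewrite /pre -imset_comp (eq_imset (g := id)) ?imset_id.
rewrite /wsum (reindex_onto (imset2 e) pre) /=; last first.
  move=> Q; rewrite inE => /andP[/partitionE[Q1 _ _] _].
  rewrite /imset2 -imset_comp -[RHS]imset_id; apply: eq_in_imset => V /Q1[VD _] /=.
  apply/setP => x; apply/imsetP/idP => [[i]|xV]; first by rewrite inE => ? ->.
  have := subsetP VD _ xV; rewrite {1}eT => /imsetP[i _ xi].
  by exists i; rewrite ?inE -?xi.
apply: eq_big => [P|P PB].
  rewrite mem_BNC !inE preQ eqxx andbT -(imset2_partition e_inj) -eT.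
  congr (_ && _); apply/esym/imset2_ncr => // i j.
  by rewrite !chi_rank_lt /chi_lt !enum_val_mono.
rewrite /cumulant_part big_imset /=; last by move=> V W _ _; apply: imset_inj.
by apply: eq_bigr => V _; rewrite kappa_imset.
Qed.
End MomentSum.

(** * Alternating moments *)

Local Open Scope ring_scope.

Section Algebra.
Variables (K : numFieldType) (A : banachAlgType K).
Implicit Types x y z : A.

Lemma bmulBl x y z : bmul (x - y) z = bmul x z - bmul y z.
Proof. by rewrite bmulDl -scaleN1r -bscalerAl scaleN1r. Qed.

Lemma bmulBr x y z : bmul x (y - z) = bmul x y - bmul x z.
Proof. by rewrite bmulDr -scaleN1r -bscalerAr scaleN1r. Qed.

Lemma big_bmul_cat (I : Type) (r1 r2 : seq I) (P : pred I) (F : I -> A) :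
  \big[bmul/bone]_(i <- r1 ++ r2 | P i) F i =
  bmul (\big[bmul/bone]_(i <- r1 | P i) F i) (\big[bmul/bone]_(i <- r2 | P i) F i).
Proof. exact: (@big_cat _ _ (@bmul K A)). Qed.

End Algebra.

Section Words.
Variables (K : numFieldType) (A : banachAlgType K) (phi : {scalar A}).
Hypothesis phi1 : phi bone = 1.
Variables (a b : bool -> A).
Hypothesis bf : bifree phi (a false) (b false) (a true) (b true).

Definition recenter (y : A) : A := y - phi y *: bone.

(* A letter is (interval index, side), the side being [true] for left; the
   colour alternates with the index. *)
Definition letter := (nat * bool)%type.

Variable e0 : bool.
Definition colour (x : letter) := e0 (+) odd x.1.
Definition lval (x : letter) : A := if x.2 then a (colour x) else b (colour x).

(** In a word sorted by this relation the left letters come first with nondecreasing indices, the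
    right letters follow with nonincreasing ones, and no left index exceeds a right one. The
    chi-order then runs through the intervals by increasing index, which is [lab_rank]. *)
Definition word_le (x y : letter) : bool :=
  if x.2 then (x.1 <= y.1)%N else ~~ y.2 && (y.1 <= x.1)%N.

Section AlternatingMoments.
Variable s : seq letter.
Hypothesis s_le : pairwise word_le s.

Definition word_moment (S : seq nat) : K :=
  phi (\big[bmul/bone]_(x <- s | x.1 \notin S) lval x).

Definition ivl_moment (j : nat) : K :=
  phi (\big[bmul/bone]_(x <- s | x.1 == j) lval x).

(** Formal centering of the intervals in [js], with [S] collecting the deleted ones. An interval may
    have letters on both sides that are not adjacent in the word, so this need not be the moment of
    a product of centered factors. *)
Fixpoint centered_moment (js S : seq nat) : K :=
  if js is j :: js' then
    centered_moment js' S - ivl_moment j * centered_moment js' (j :: S)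
  else word_moment S.

Let let_ (i : 'I_(size s)) : letter := tnth (in_tuple s) i.
Let chi i := (let_ i).2.
Let lab i := (let_ i).1.
Let eps i := colour (let_ i).
Let c i := lval (let_ i).
Let kap := kappa phi chi c.

Let lab_rank x y : (lab x < lab y)%N -> (chi_rank chi x < chi_rank chi y)%N.
Proof.
rewrite chi_rank_lt /chi_lt /chi /lab /let_ => xy.
have le_ (i j : 'I_(size s)) : (i < j)%N -> word_le (let_ i) (let_ j).
  move=> ij; have /pairwiseP := s_le; rewrite /let_ !(tnth_nth (0%N, true)) /=.
  by apply; rewrite ?inE.
case: (ltngtP x y) => [/le_|/le_|/val_inj xyE]; last by rewrite xyE ltnn in xy.
- by rewrite /word_le /let_; case: ifP => //=; [rewrite implybT | lia].
- rewrite /word_le /let_; case: ifP => //= _; first by lia.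
  by case: ifP => //= _; lia.
Qed.

Let kap_mixed (V : {set 'I_(size s)}) x y :
  x \in V -> y \in V -> eps x != eps y -> kap V = 0.
Proof.
move=> xV yV xy; pose ep (i : 'I_#|V|) := eps (enum_val i).
have := @bf #|V| (fun i => chi (enum_val i)) ep.
rewrite /kap /kappa; move=> <-.
- congr cumulant; apply: boolp.funext => i; rewrite /c /lval -/(chi _) /ep /eps.
  by case: (chi _); case: (colour _).
- rewrite (cardsD1 x) (cardsD1 y) xV !inE yV andbT.
  by have -> : y != x by apply: contraNneq xy => ->.
- exists (enum_rank_in xV x), (enum_rank_in yV y).
  by rewrite /ep !enum_rankK_in.
Qed.

Let rest (S : seq nat) := [set i | lab i \notin S].

Let wsum_rest S : wsum (chi_rank chi) kap (rest S) = word_moment S.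
Proof.
rewrite -moment_wsum // /word_moment [in RHS]big_tnth; congr (phi _).
by apply: eq_bigl => i; rewrite inE.
Qed.

Let wsum_ivl j : wsum (chi_rank chi) kap (ivl lab j) = ivl_moment j.
Proof.
rewrite -moment_wsum // /ivl_moment [in RHS]big_tnth; congr (phi _).
by apply: eq_bigl => i; rewrite inE.
Qed.

Let unsat_sum_centered js S : uniq js -> (forall j, j \in js -> j \notin S) ->
  unsat_sum (chi_rank chi) lab kap js (rest S) = centered_moment js S.
Proof.
elim: js S => [|j js IH] S /=.
  move=> _ _; rewrite -wsum_rest /unsat_sum /wsum.
  by apply: eq_bigl => P; rewrite andbT.
move=> /andP[jjs ujs] jS; rewrite unsat_sum_cons //.
have jS' := jS j (mem_head _ _).
have -> : rest S :&: ivl lab j = ivl lab j.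
  by apply/setP => i; rewrite !inE; case: eqP => [->|_]; rewrite ?andbF ?jS'.
have -> : rest S :\: ivl lab j = rest (j :: S).
  by apply/setP => i; rewrite !inE negb_or.
rewrite wsum_ivl !IH // => i ijs; last by rewrite jS // inE ijs orbT.
rewrite inE negb_or jS ?inE ?ijs ?orbT // andbT.
by apply: contraNneq jjs => <-.
Qed.

(** By [unsat_sum_centered] the formal centering of all intervals is a sum over partitions that
    saturate none of them. Bi-freeness makes the weights of two-coloured blocks vanish, so
    [unsat_sum0] applies. *)
Lemma centered_moment0 js k : (0 < k)%N -> (forall x, x \in s -> x.1 < k)%N ->
  uniq js -> (forall j, j < k -> j \in js)%N -> centered_moment js [::] = 0.
Proof.
move=> k0 sk ujs jsk; rewrite -unsat_sum_centered //.
apply: (@unsat_sum0 _ _ _ lab_rank _ kap eps e0 _ kap_mixed _ _ k) => //.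
by move=> i; apply: sk; apply: mem_tnth.
Qed.

End AlternatingMoments.

Section Slots.
Variables (t : seq letter) (ns : letter -> nat).

Let word := flatten [seq nseq (ns x) x | x <- t].

Lemma big_word (P : pred letter) :
  \big[bmul/bone]_(x <- word | P x) lval x =
  \big[bmul/bone]_(x <- t) (if P x then bexp (lval x) (ns x) else bone).
Proof.
rewrite /word; elim: t => [|x t' IH]; first by rewrite !big_nil.
rewrite /= big_bmul_cat IH big_cons; congr (bmul _ _).
rewrite big_nseq_cond; case: (P x) => //.
Qed.

Definition slot (js S : seq nat) (x : letter) : A :=
  if x.1 \in S then bone else
  let y := bexp (lval x) (ns x) in if x.1 \in js then recenter y else y.

Lemma centered_moment_slots js S : uniq js -> (forall j, j \in js -> j \notin S) ->
  (forall j, j \in js -> count (fun x => x.1 == j) t = 1%N) ->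
  centered_moment word js S = phi (\big[bmul/bone]_(x <- t) slot js S x).
Proof.
elim: js S => [|j js IH] S /=.
  move=> _ _ _; rewrite /word_moment big_word; congr (phi _).
  by apply: eq_bigr => x _; rewrite /slot; case: (x.1 \in S).
move=> /andP[jjs ujs] jS j1.
have jS' := jS j (mem_head _ _).
have mem_js i : i \in js -> i \in j :: js by rewrite inE => ->; rewrite orbT.
rewrite IH //; [|by move=> i /mem_js/jS|by move=> i /mem_js/j1].
rewrite IH //; [|move=> i ijs|by move=> i /mem_js/j1]; last first.
  rewrite inE negb_or jS ?mem_js // andbT.
  by apply: contraNneq jjs => <-.
have [x0 [t1 [t2 [tE x0j tj]]]] : exists x0 t1 t2,
    [/\ t = t1 ++ x0 :: t2, x0.1 = j & forall x, x \in t1 ++ t2 -> x.1 != j].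
  have cj := j1 j (mem_head _ _).
  have /hasP[x0 x0t /eqP x0j] : has (fun x : letter => x.1 == j) t by rewrite has_count cj.
  case/splitPr: x0t cj => t1 t2 cj; exists x0, t1, t2; split=> // x xt.
  apply: contraTneq xt => xj; rewrite -has_pred1 has_count -leqNgt.
  apply: (@leq_trans (count (fun x : letter => x.1 == j) (t1 ++ t2))).
    by apply: sub_count => y /eqP ->; rewrite xj eqxx.
  by move: cj; rewrite !count_cat /= x0j eqxx addnCA add1n => -[->].
have slotE js' S' F : (forall x, x.1 != j -> slot js' S' x = F x) ->
    \big[bmul/bone]_(x <- t) slot js' S' x =
    bmul (\big[bmul/bone]_(x <- t1) F x)
      (bmul (slot js' S' x0) (\big[bmul/bone]_(x <- t2) F x)).
  move=> FE; rewrite tE big_bmul_cat big_cons; congr (bmul _ (bmul _ _)).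
    by rewrite !big_seq; apply: eq_bigr => x xt; rewrite FE // tj // mem_cat xt.
  by rewrite !big_seq; apply: eq_bigr => x xt; rewrite FE // tj // mem_cat xt orbT.
have ivlE : ivl_moment word j = phi (bexp (lval x0) (ns x0)).
  rewrite /ivl_moment big_word tE big_bmul_cat big_cons x0j eqxx.
  have one t' : {subset t' <= t1 ++ t2} ->
      \big[bmul/bone]_(x <- t') (if x.1 == j then bexp (lval x) (ns x) else bone) = bone.
    move=> t't; rewrite big_seq; elim/big_rec: _ => // x y /t't/tj/negbTE-> ->.
    by rewrite bmul1r.
  rewrite !one ?bmul1r ?bmulr1 // => x xt; rewrite mem_cat xt ?orbT //.
pose F := slot js S.
rewrite (slotE js S F) // (slotE js (j :: S) F); last first.
  by move=> x xj; rewrite /F /slot inE (negbTE xj).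
rewrite (slotE (j :: js) S F); last first.
  by move=> x xj; rewrite /F /slot [x.1 \in j :: js]inE (negbTE xj).
rewrite /slot x0j (negbTE jS') (negbTE jjs) !inE eqxx /= ivlE.
by rewrite /recenter bmulBl bmulBr linearB /= -bscalerAl -bscalerAr linearZ.
Qed.

End Slots.
End Words.

(** * Factorization of moments of alternating words *)

Section Freeness.
Variables (K : numFieldType) (A : banachAlgType K) (phi : {scalar A}).

(* Alternating products of centered powers whose last factor does not have
   colour [e]; [ns] lists the exponents from right to left. *)
Fixpoint alt (c : bool -> A) (e : bool) (ns : seq nat) : A :=
  if ns is n :: ns' then bmul (alt c (~~ e) ns') (recenter phi (bexp (c (~~ e)) n))
  else bone.

Lemma alt_big (c : bool -> A) e ns :
  alt c e ns = \big[bmul/bone]_(i <- rev (iota 0 (size ns)))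
    recenter phi (bexp (c (e (+) ~~ odd i)) (nth 0%N ns i)).
Proof.
elim: ns e => [|n ns IH] e /=; first by rewrite big_nil.
rewrite rev_cons -cats1 big_bmul_cat big_cons big_nil bmulr1 /= addbT.
congr (bmul _ _); rewrite IH (iotaDl 1 0) -map_rev big_map; apply: eq_bigr => i _.
by rewrite /= !addbN addNb.
Qed.

Lemma pairwise_rev_iota p : pairwise (fun i j => j < i)%N (rev (iota 0 p)).
Proof.
rewrite -sorted_pairwise; last by move=> x y z xy yz; apply: ltn_trans yz xy.
by rewrite rev_sorted iota_ltn_sorted.
Qed.

Lemma pairwise_flatten_nseq (T : eqType) (r : rel T) (ns : T -> nat) (t : seq T) :
  reflexive r -> pairwise r t -> pairwise r (flatten [seq nseq (ns x) x | x <- t]).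
Proof.
move=> rr; elim: t => //= x t IH /andP[/allP xt /IH {}IH]; rewrite pairwise_cat IH andbT.
apply/andP; split.
  apply/allrelP => y z; rewrite mem_nseq => /andP[_ /eqP->].
  by case/flattenP => _ /mapP[w wt ->]; rewrite mem_nseq => /andP[_ /eqP->]; apply: xt.
by elim: (ns x) => //= k ->; rewrite all_nseq rr orbT.
Qed.

Hypothesis phi1 : phi bone = 1.
Variables (a b : bool -> A).
Hypothesis bf : bifree phi (a false) (b false) (a true) (b true).

(** The powers of [a e] and [b e] together form one interval spread over both sides, and each
    centered factor is an interval of its own. The formal centering of all intervals vanishes;
    undoing it for the shared interval gives the difference of the two sides. *)
Lemma phi_alt_powers e nL nR n m :
  phi (bmul (bmul (alt a e nL) (bexp (a e) n)) (bmul (alt b e nR) (bexp (b e) m))) =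
  phi (bmul (bexp (a e) n) (bexp (b e) m)) * phi (bmul (alt a e nL) (alt b e nR)).
Proof.
pose p := size nL; pose r := size nR.
(* This makes [e] the colour of interval [p]. *)
pose e0 := e (+) odd p.
(* Intervals below [p] are the left centered factors numbered from left to right, interval [p] holds
   the two powers, and those above [p] are the right centered factors numbered from right to
   left. *)
pose tL : seq letter := [seq ((p - i.+1)%N, true) | i <- rev (iota 0 p)].
pose tR : seq letter := [seq ((p.+1 + i)%N, false) | i <- rev (iota 0 r)].
pose t := tL ++ (p, true) :: tR ++ [:: (p, false)].
pose ns (x : letter) := if x.2 then (if x.1 == p then n else nth 0%N nL (p - x.1).-1)
  else if x.1 == p then m else nth 0%N nR (x.1 - p.+1).
pose word := flatten [seq nseq (ns x) x | x <- t].
pose js := [seq j <- iota 0 (p + r).+1 | j != p].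
have tL_lt x : x \in tL -> (x.1 < p)%N /\ x.2.
  by case/mapP => i; rewrite mem_rev mem_iota => /andP[_ ip] -> /=; split=> //; lia.
have tR_gt x : x \in tR -> (p < x.1 < (p + r).+1)%N /\ x.2 = false.
  by case/mapP => i; rewrite mem_rev mem_iota => /andP[_ ip] -> /=; split=> //; lia.
have word_mem x : x \in word -> x \in t.
  by case/flattenP => _ /mapP[y yt ->]; rewrite mem_nseq => /andP[_ /eqP->].
have word_pw : pairwise word_le word.
  apply: pairwise_flatten_nseq; first by move=> [? []]; rewrite /word_le /=.
  have allR (q : letter) : q.2 -> (q.1 <= p)%N -> all (word_le q) (tR ++ [:: (p, false)]).
    move=> q2 qp; rewrite all_cat /= /word_le q2 qp !andbT; apply/allP => x /tR_gt[/andP[px _] _].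
    exact: leq_trans qp (ltnW px).
  rewrite /t pairwise_cat pairwise_cons allR //= pairwise_cat /= !andbT.
  apply/and4P; split.
  - apply/allrelP => x y /tL_lt[xp x2]; rewrite inE => /predU1P[->|yR].
      by rewrite /word_le x2 ltnW.
    by have /allP := allR x x2 (ltnW xp); apply.
  - rewrite pairwise_map.
    apply: (sub_in_pairwise (P := [pred i | i < p]%N) _ _ (pairwise_rev_iota p)).
      by move=> i j /=; rewrite !inE /word_le /=; lia.
    by rewrite all_rev; apply/allP => i; rewrite mem_iota.
  - by apply/allrelP => x y /tR_gt[/andP[px _] x2]; rewrite inE /word_le x2 => /eqP->; apply: ltnW.
  - rewrite pairwise_map; apply: sub_pairwise (pairwise_rev_iota r) => i j.
    by rewrite /= /word_le /=; lia.
have slotsE S : (forall j, j \in S -> j = p) ->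
    \big[bmul/bone]_(x <- t) slot phi a b e0 ns js S x =
    bmul (bmul (alt a e nL) (if p \in S then bone else bexp (a e) n))
         (bmul (alt b e nR) (if p \in S then bone else bexp (b e) m)).
  move=> Sp; rewrite big_bmul_cat big_cons big_bmul_cat big_cons big_nil bmulr1.
  have notS j : j != p -> (j \in S) = false.
    by move=> jp; apply: contraNF jp => /Sp ->.
  have pjs : p \in js = false by rewrite mem_filter eqxx.
  have mid side : slot phi a b e0 ns js S (p, side) =
      if p \in S then bone else if side then bexp (a e) n else bexp (b e) m.
    rewrite /slot pjs /=; case: (p \in S) => //.
    by rewrite /lval /ns /colour /e0 /= eqxx addbK; case: side.
  have pow (c : bool -> A) i k x : x.1 != p -> (x.1 < (p + r).+1)%N ->
      lval a b e0 x = c (e (+) ~~ odd i) -> ns x = k ->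
      slot phi a b e0 ns js S x = recenter phi (bexp (c (e (+) ~~ odd i)) k).
    move=> xp xr vE kE; rewrite /slot (notS _ xp) mem_filter xp mem_iota /= add0n xr.
    by rewrite vE kE.
  rewrite !mid bmulA; congr (bmul (bmul _ _) (bmul _ _)).
    rewrite alt_big big_map; apply: eq_big_seq => i.
    rewrite mem_rev mem_iota add0n => /andP[_ ip]; apply: pow => /=; try lia.
      by rewrite /lval /colour /e0 /= oddB //= addbA addbK.
    by rewrite /ns /=; case: eqP => ?; [lia|congr (nth _ _ _); lia].
  rewrite alt_big big_map; apply: eq_big_seq => i.
  rewrite mem_rev mem_iota add0n => /andP[_ ip]; apply: pow => /=; try lia.
    by rewrite /lval /colour /e0 /= oddD -addbN addbA addbK.
  by rewrite /ns /=; case: eqP => ?; [lia|congr (nth _ _ _); lia].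
have js1 j : j \in js -> count (fun x : letter => x.1 == j) t = 1%N.
  rewrite mem_filter mem_iota add0n => /andP[jp jr].
  rewrite count_cat /= count_cat /= [p == j]eq_sym (negbTE jp) !addn0 add0n.
  rewrite -!(count_map fst (pred1 j)) -!map_comp !count_uniq_mem; first last.
  - rewrite map_inj_in_uniq ?rev_uniq ?iota_uniq // => i k.
    by rewrite !mem_rev !mem_iota /= !add0n => ip kp; lia.
  - by rewrite map_inj_in_uniq ?rev_uniq ?iota_uniq // => i k _ _ /= /addnI.
  have [jlt|jgt] := ltnP j p.
    have -> : j \in [seq (fst \o (fun i => ((p - i.+1)%N, true))) i | i <- rev (iota 0 p)].
      apply/mapP; exists (p - j.+1)%N; last by rewrite /=; lia.
      by rewrite mem_rev mem_iota; lia.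
    suff /negbTE-> :
      j \notin [seq (fst \o (fun i => ((p.+1 + i)%N, false))) i | i <- rev (iota 0 r)] by [].
    by apply/mapP => -[i _ /= ji]; move: jlt; rewrite ji; lia.
  have -> : j \in [seq (fst \o (fun i => ((p.+1 + i)%N, false))) i | i <- rev (iota 0 r)].
    apply/mapP; exists (j - p.+1)%N; last by rewrite /=; lia.
    by rewrite mem_rev mem_iota; lia.
  suff /negbTE-> :
    j \notin [seq (fst \o (fun i => ((p - i.+1)%N, true))) i | i <- rev (iota 0 p)] by [].
  apply/mapP => -[i]; rewrite mem_rev mem_iota add0n /= => ip ji.
  by move: jgt; rewrite ji; lia.
have js_uniq : uniq js by rewrite filter_uniq // iota_uniq.
have ivlE : ivl_moment phi a b e0 word p = phi (bmul (bexp (a e) n) (bexp (b e) m)).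
  rewrite /ivl_moment big_word big_bmul_cat big_cons big_bmul_cat big_cons big_nil /=.
  have one (u : seq letter) : (forall x, x \in u -> x.1 != p) ->
     \big[bmul/bone]_(x <- u) (if x.1 == p then bexp (lval a b e0 x) (ns x) else bone) = bone.
    move=> up; rewrite big_seq; elim/big_rec: _ => // x y /up/negbTE-> ->.
    by rewrite bmul1r.
  rewrite !one; first last.
  - by move=> x /tL_lt[xp _]; rewrite ltn_eqF.
  - by move=> x /tR_gt[/andP[px _] _]; rewrite gtn_eqF.
  rewrite eqxx bmulr1 !bmul1r /lval /ns /colour /e0 /= eqxx addbK; congr (phi _).
(* With [p] at the head of the list, one unfolding of [centered_moment] gives the full moment minus
   the moment of interval [p] times the moment without it; [slotsE] evaluates these for [S] empty
   and [S = [:: p]]. *)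
have := @centered_moment0 _ _ phi phi1 a b bf e0 word word_pw (p :: js) (p + r).+1.
have jsp j : j \in js -> j != p by rewrite mem_filter => /andP[].
rewrite /= ivlE !centered_moment_slots //; last first.
  by move=> j /jsp; rewrite inE.
rewrite !slotsE //; last by move=> j; rewrite inE => /eqP.
rewrite mem_head in_nil !bmulr1 => H; apply/eqP; rewrite -subr_eq0; apply/eqP/H => //.
- move=> x /word_mem; rewrite mem_cat inE mem_cat inE.
  case/or4P => [/tL_lt[xp _]|/eqP->|/tR_gt[/andP[_ xr] _]|].
  - by rewrite ltnS (leq_trans (ltnW xp)) ?leq_addr.
  - by rewrite ltnS leq_addr.
  - by [].
  - by move=> /eqP->; rewrite ltnS leq_addr.
- by rewrite js_uniq andbT; apply/negP => /jsp; rewrite eqxx.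
- by move=> j jp; rewrite inE mem_filter mem_iota /= add0n jp andbT; case: eqP.
Qed.
End Freeness.

(* Imported only now: classical_sets shadows the finset notations used above. *)
From mathcomp Require Import ring.
From mathcomp Require Import boolp classical_sets reals topology normedtype sequences.
From mathcomp Require Import complex.

Import Order.TTheory Num.Theory.
Import numFieldNormedType.Exports.

Local Open Scope classical_set_scope.

(** * Resolvents and local inverses *)

Lemma near0P (K : numFieldType) (P : K -> Prop) :
  (\forall z \near (0 : K), P z) <-> exists2 d : K, 0 < d & forall z, `|z| < d -> P z.
Proof.
split=> [/nbhs_ballP[d /= d0 dP]|[d d0 dP]].
  by exists d => // z zd; apply: dP; rewrite /ball /= sub0r normrN.
apply/nbhs_ballP; exists d => //= z; rewrite /ball /= sub0r normrN; exact: dP.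
Qed.

Lemma near0_mul_le (K : numFieldType) (C e : K) : 0 <= C -> 0 < e ->
  \forall z \near (0 : K), C * `|z| <= e.
Proof.
move=> C0 e0; apply/near0P; exists (e / (C + 1)); first by rewrite divr_gt0 // ltr_wpDl.
move=> z zd; have C1 : 0 < C + 1 by rewrite ltr_wpDl.
apply: (@le_trans _ _ ((C + 1) * `|z|)); first by rewrite ler_wpM2r // lerDl.
by rewrite mulrC -ler_pdivlMr // ltW.
Qed.

Lemma norm_eq0_le (K : numFieldType) (V : normedModType K) (x : V) :
  (forall e : K, 0 < e -> `|x| <= e) -> x = 0.
Proof.
move=> H; apply/eqP; apply: contraT => x0; have xp : 0 < `|x| by rewrite normr_gt0.
have := H (`|x| / 2) (divr_gt0 xp (ltr0Sn _ _)).
by rewrite ler_pdivlMr // mulr_natr mulr2n gerDl normr_le0 (negbTE x0).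
Qed.

(** The archimedean property in the form used by the geometric estimates; it makes sense for a
    partial order and so covers [R[i]]. *)
Definition halving (K : numFieldType) := forall e : K, 0 < e -> exists n, 2^-1 ^+ n <= e.

Lemma halving_complex (R : realType) : halving R[i].
Proof.
move=> [x y]; rewrite ltcE /= => /andP[/eqP-> x0].
have [n nx] : exists n, x^-1 <= n%:R.
  by exists (Num.bound x^-1); rewrite ltW // archi_boundP // invr_ge0 ltW.
exists n.
have -> : (2^-1 : R[i]) ^+ n = ((2^-1 ^+ n)%:C)%C.
  by rewrite rmorphXn /= fmorphV rmorph_nat.
rewrite lecE /= eqxx /= -[leRHS]invrK exprVn lef_pV2 ?posrE ?invr_gt0 ?exprn_gt0 //.
apply: (le_trans nx); rewrite -natrX ler_nat.
by rewrite ltnW // ltn_expl.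
Qed.

Section FixedPoint.
Variables (K : numFieldType) (hK : halving K) (V : completeNormedModType K).

Lemma geometric_small (C e : K) : 0 <= C -> 0 < e ->
  exists N, forall n, (N <= n)%N -> C * 2^-1 ^+ n <= e.
Proof.
move=> C0 e0; have C1 : 0 < C + 1 by rewrite ltr_wpDl.
have [N NE] := hK (divr_gt0 e0 C1); exists N => n Nn.
apply: (@le_trans _ _ ((C + 1) * 2^-1 ^+ n)).
  by rewrite ler_wpM2r ?lerDl // exprn_ge0 // invr_ge0.
rewrite mulrC -ler_pdivlMr //; apply: le_trans NE.
by rewrite ler_wiXn2l ?invr_ge0 // invf_le1 // ler1n.
Qed.

(** Banach iteration from 0. The factor 4 keeps the iterates in the ball of radius [rho / 2], which
    leaves room for their limit in the ball of radius [rho]. The final bound comes from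
    [|x| <= |x| / 2 + |T 0|]. *)
Lemma fixed_point (T : V -> V) (rho : K) :
  (forall x y, `|x| <= rho -> `|y| <= rho -> `|T x - T y| <= `|x - y| / 2) ->
  0 < rho -> 4 * `|T 0| <= rho -> exists2 x, T x = x & `|x| <= 2 * `|T 0|.
Proof.
move=> Tc rho0 T0.
have T0r : 2 * `|T 0| <= rho.
  by apply: le_trans T0; rewrite ler_wpM2r // ler_nat.
have two0 : (0 : K) < 2 by [].
pose x n := iter n T 0.
have xb n : `|x n| <= 2 * `|T 0|.
  elim: n => [|n IH]; first by rewrite normr0 mulr_ge0.
  rewrite -[x n.+1]/(T (x n)) -[T _](subrK (T 0)); apply: le_trans (ler_normD _ _) _.
  rewrite mulr_natl mulr2n lerD //; apply: le_trans (Tc _ _ (le_trans IH T0r) _) _.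
    by rewrite normr0 ltW.
  by rewrite subr0 ler_pdivrMr // mulrC.
have xr n : `|x n| <= rho := le_trans (xb n) T0r.
have xS n : `|x n.+1 - x n| <= `|T 0| * 2^-1 ^+ n.
  elim: n => [|n IH]; first by rewrite /x /= subr0 expr0 mulr1.
  apply: le_trans (Tc (x n.+1) (x n) (xr _) (xr _)) _.
  by rewrite exprSr mulrA ler_wpM2r // invr_ge0.
have xD n m : `|x (n + m)%N - x n| <= 2 * `|T 0| * 2^-1 ^+ n.
  (* The partial geometric sum is written as a difference, so that the induction on [m]
     telescopes. *)
  suff : `|x (n + m)%N - x n| <= `|T 0| * (2 * 2^-1 ^+ n - 2 * 2^-1 ^+ (n + m)).
    move=> /le_trans; apply; rewrite [2 * `|_|]mulrC -[leRHS]mulrA ler_wpM2l // gerBl.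
    by rewrite mulr_ge0 // exprn_ge0 // invr_ge0.
  elim: m => [|m IH]; first by rewrite addn0 !subrr normr0 mulr0.
  rewrite addnS; have -> : x (n + m).+1 - x n = x (n + m)%N - x n + (x (n + m).+1 - x (n + m)%N).
    by rewrite [RHS]addrC subrKA.
  apply: le_trans (ler_normD _ _) _.
  apply: le_trans (lerD IH (xS _)) _; rewrite -mulrDr ler_wpM2l //.
  rewrite exprS mulrA mulfV ?pnatr_eq0 // mul1r -addrA lerD2l.
  by rewrite mulr_natl mulr2n opprD addrNK.
have T0e (e : K) (e0 : 0 < e) := @geometric_small (2 * `|T 0|) e (mulr_ge0 (ltW two0) (normr_ge0 _)) e0.
have [l xl] : exists l, forall e : K, 0 < e -> exists n, forall m, (n <= m)%N -> `|l - x m| <= e.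
  have : cvgn x.
    apply/cauchy_cvgP; apply/cauchy_ballP => e e0; near_simpl.
    have [N HN] := T0e (e / 4) (divr_gt0 e0 (ltr0Sn _ _)).
    exists ([set n | (N <= n)%N], [set n | (N <= n)%N]) => /=; first by split; exists N.
    move=> [n m] /= [Nn Nm]; rewrite -ball_normE /=.
    rewrite -(subrKA (x N)); apply: le_lt_trans (ler_normD _ _) _.
    rewrite [`|x N - _|]distrC; have := lerD (xD N (n - N)%N) (xD N (m - N)%N).
    rewrite !subnKC // => /le_lt_trans; apply.
    apply: le_lt_trans (lerD (HN N (leqnn _)) (HN N (leqnn _))) _.
    by rewrite -mulrDl ltr_pdivrMr // -mulr2n mulr_natr ltr_pMn2l.
  move=> /cvg_ex[l xl]; exists l => e e0.
  by have /cvgrPdist_le/(_ e e0)[N _ HN] := xl; exists N => m /HN.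
have lrho : `|l| <= rho.
  have rho2 : 0 < rho / 2 by rewrite divr_gt0.
  have [n /(_ n (leqnn _)) ln] := xl _ rho2.
  rewrite -[l](subrK (x n)); apply: le_trans (ler_normD _ _) _.
  rewrite [leRHS](splitr rho) lerD //; apply: le_trans (xb n) _.
  by rewrite ler_pdivlMr // mulrAC -natrM.
have Tl : T l = l.
  apply/eqP; rewrite -subr_eq0; apply/eqP/norm_eq0_le => e e0.
  have e2 : 0 < e / 2 by rewrite divr_gt0.
  have [n Hn] := xl _ e2; rewrite -(subrKA (x n.+1)); apply: le_trans (ler_normD _ _) _.
  rewrite (splitr e) lerD //; last by rewrite distrC Hn.
  apply: le_trans (Tc l (x n) lrho (xr n)) _; rewrite ler_pdivrMr //.
  by apply: le_trans (Hn n (leqnn _)) _; rewrite ler_peMr ?ler1n // ltW.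
exists l => //; have := Tc l 0 lrho; rewrite normr0 subr0 => /(_ (ltW rho0)) lT.
have : `|l| <= `|l| / 2 + `|T 0|.
  by rewrite -{1}Tl -[T l](subrK (T 0)); apply: le_trans (ler_normD _ _) _; rewrite lerD2r.
rewrite -lerBlDl; have -> : `|l| - `|l| / 2 = `|l| / 2 by rewrite [X in X - _]splitr addrK.
by rewrite ler_pdivrMr // mulrC.
Qed.
End FixedPoint.

(** * Bounded functionals, closed spans and resolvents *)

Section BoundedFunctionals.
Variables (K : numFieldType) (A : banachAlgType K).
Implicit Types (f g : A -> K) (S : A -> Prop) (x y z : A) (k : K).

(** A predicate on plain functions, so that compositions with multiplications and differences of
    functionals qualify without being bundled as linear maps. *)
Definition bounded_functional f :=
  (forall k x y, f (k *: x + y) = k * f x + f y) /\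
  exists2 M, 0 <= M & forall x, `|f x| <= M * `|x|.

Lemma bfunD f x y : bounded_functional f -> f (x + y) = f x + f y.
Proof. by move=> [fl _]; rewrite -[x]scale1r fl mul1r scale1r. Qed.

Lemma bfun0 f : bounded_functional f -> f 0 = 0.
Proof. by move=> ff; apply: (addrI (f 0)); rewrite -bfunD // !addr0. Qed.

Lemma bfunZ f k x : bounded_functional f -> f (k *: x) = k * f x.
Proof. by move=> ff; rewrite -[k *: x]addr0 ff.1 bfun0 // addr0. Qed.

Lemma bfunB f x y : bounded_functional f -> f (x - y) = f x - f y.
Proof. by move=> ff; rewrite bfunD // -scaleN1r bfunZ // mulN1r. Qed.

Lemma bfun_mull f p : bounded_functional f -> bounded_functional (fun x => f (bmul p x)).
Proof.
move=> ff; split=> [k x y|]; first by rewrite bmulDr -bscalerAr ff.1.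
have [M M0 fM] := ff.2; exists (M * `|p|); first by rewrite mulr_ge0.
move=> x; apply: le_trans (fM _) _; rewrite -mulrA ler_wpM2l //; exact: bnormM.
Qed.

Lemma bfun_mulr f q : bounded_functional f -> bounded_functional (fun x => f (bmul x q)).
Proof.
move=> ff; split=> [k x y|]; first by rewrite bmulDl -bscalerAl ff.1.
have [M M0 fM] := ff.2; exists (M * `|q|); first by rewrite mulr_ge0.
by move=> x; apply: le_trans (fM _) _; rewrite -mulrA ler_wpM2l // mulrC bnormM.
Qed.

Lemma bfun_lin f g k : bounded_functional f -> bounded_functional g ->
  bounded_functional (fun x => f x - k * g x).
Proof.
move=> ff gg; split=> [l x y|]; first by rewrite ff.1 gg.1; ring.
have [M M0 fM] := ff.2; have [N N0 gN] := gg.2.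
exists (M + `|k| * N); first by rewrite addr_ge0 ?mulr_ge0.
move=> x; apply: le_trans (ler_normB _ _) _; rewrite mulrDl lerD // normrM -mulrA.
by rewrite ler_wpM2l.
Qed.

(* The closed span of [S], described by its annihilator. *)
Definition closed_span S x :=
  forall f, bounded_functional f -> (forall y, S y -> f y = 0) -> f x = 0.

Lemma mem_closed_span S x : S x -> closed_span S x.
Proof. by move=> Sx f _; apply. Qed.

Lemma closed_span_lin S k x y : closed_span S x -> closed_span S y -> closed_span S (k *: x + y).
Proof. by move=> Sx Sy f ff fS; rewrite ff.1 Sx // Sy // mulr0 addr0. Qed.

Lemma closed_span_eq S f g x : bounded_functional f -> bounded_functional g ->
  (forall y, S y -> f y = g y) -> closed_span S x -> f x = g x.
Proof.
move=> ff gg fg Sx; apply/eqP; rewrite -subr_eq0 -[g x]mul1r; apply/eqP.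
apply: (Sx (fun x => f x - 1 * g x)); first exact: bfun_lin.
by move=> y /fg ->; rewrite mul1r subrr.
Qed.

End BoundedFunctionals.

Section Resolvents.
Variables (K : numFieldType) (hK : halving K) (A : banachAlgType K).
Implicit Types (f : A -> K) (x y z : A).

Lemma bmulr0 x : bmul x 0 = 0.
Proof. by rewrite -(subrr (0 : A)) bmulBr !subrr. Qed.

Lemma bmul0r x : bmul 0 x = 0.
Proof. by rewrite -(subrr (0 : A)) bmulBl !subrr. Qed.

Definition resolvent x y := bmul (bone - x) y = bone /\ bmul y (bone - x) = bone.

Lemma resolvent_uniq x y z : resolvent x y -> bmul (bone - x) z = bone -> y = z.
Proof. by move=> [_ yx] xz; rewrite -[y]bmulr1 -xz bmulA yx bmul1r. Qed.

Lemma resolventEl x y : resolvent x y -> y = bone + bmul x y.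
Proof. by move=> [h _]; rewrite -h bmulBl bmul1r subrK. Qed.

Lemma resolventEr x y : resolvent x y -> y = bone + bmul y x.
Proof. by move=> [_ h]; rewrite -[in RHS]h bmulBr bmulr1 subrK. Qed.

(** [y = 1 + x y] and [z = 1 + z x] are fixed point equations of contractions, and a right and a
    left inverse of [1 - x] coincide. The bound keeps the norm of [bone], which may differ from
    1. *)
Lemma resolvent_exists x : `|x| <= 2^-1 -> exists2 y, resolvent x y & `|y| <= 2 * `|bone : A|.
Proof.
move=> x2; have rho0 : 0 < 4 * `|bone : A| + 1 by rewrite ltr_wpDl ?mulr_ge0.
have [y yE yb] : exists2 y, bone + bmul x y = y & `|y| <= 2 * `|bone + bmul x 0|.
  apply: (fixed_point hK (rho := 4 * `|bone : A| + 1)) => //.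
    move=> y z _ _; rewrite opprD addrACA subrr add0r -bmulBr.
    by apply: le_trans (bnormM _ _) _; rewrite mulrC ler_wpM2l.
  by rewrite bmulr0 addr0 lerDl.
have [z zE _] : exists2 y, bone + bmul y x = y & `|y| <= 2 * `|bone + bmul 0 x|.
  apply: (fixed_point hK (rho := 4 * `|bone : A| + 1)) => //.
    move=> y' z _ _; rewrite opprD addrACA subrr add0r -bmulBl.
    by apply: le_trans (bnormM _ _) _; rewrite ler_wpM2l.
  by rewrite bmul0r addr0 lerDl.
have xy : bmul (bone - x) y = bone by rewrite bmulBl bmul1r -{1}yE addrK.
have zx : bmul z (bone - x) = bone by rewrite bmulBr bmulr1 -{1}zE addrK.
have yz : z = y by rewrite -[z]bmulr1 -xy bmulA zx bmul1r.
exists y; first by split=> //; rewrite -yz.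
by move: yb; rewrite bmulr0 addr0.
Qed.

Lemma bexpSr x n : bexp x n.+1 = bmul (bexp x n) x.
Proof. by elim: n => [|n /= IH]; rewrite /= ?bmul1r ?bmulr1 // -bmulA IH. Qed.

Lemma bexpZ (k : K) x n : bexp (k *: x) n = k ^+ n *: bexp x n.
Proof.
elim: n => [|n IH]; first by rewrite expr0 scale1r.
by rewrite /= IH -bscalerAl -bscalerAr scalerA exprS.
Qed.

Lemma norm_bexp_mul x y n : `|x| <= 2^-1 -> `|bmul (bexp x n) y| <= `|y| * 2^-1 ^+ n.
Proof.
move=> x2; elim: n => [|n IH]; first by rewrite bmul1r expr0 mulr1.
rewrite /= -bmulA; apply: le_trans (bnormM _ _) _.
by rewrite exprSr mulrA mulrC ler_pM.
Qed.

Lemma resolvent_sum x y n : resolvent x y ->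
  y = \sum_(i < n) bexp x i + bmul (bexp x n) y.
Proof.
move=> xy; elim: n => [|n IH]; first by rewrite big_ord0 add0r bmul1r.
by rewrite big_ord_recr bexpSr -bmulA /= -addrA -[X in _ + (X + _)]bmulr1 -bmulDr -resolventEl.
Qed.

Lemma bfun_resolvent_le f x y : bounded_functional f -> resolvent x y -> `|x| <= 2^-1 ->
  forall e, 0 < e -> exists N, forall n, (N <= n)%N ->
    `|f y - \sum_(i < n) f (bexp x i)| <= e.
Proof.
move=> ff xy x2 e e0; have [M M0 fM] := ff.2.
have [N NE] := geometric_small hK (mulr_ge0 M0 (normr_ge0 y)) e0; exists N => n /NE He.
have fsum : f (\sum_(i < n) bexp x i) = \sum_(i < n) f (bexp x i).
  elim/big_rec2: _ => [|i u v _ <-]; [exact: bfun0 | exact: bfunD].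
rewrite {1}(resolvent_sum n xy) bfunD // fsum addrAC subrr add0r.
apply: le_trans (fM _) _; apply: le_trans He.
by rewrite -mulrA ler_wpM2l // norm_bexp_mul.
Qed.

Lemma bfun_resolvent_cvg f x y : bounded_functional f -> resolvent x y -> `|x| <= 2^-1 ->
  limn [series f (bexp x n)]_n = f y.
Proof.
move=> ff xy x2; apply: cvg_lim => //.
apply/cvgrPdist_le => e e0; have [N HN] := bfun_resolvent_le ff xy x2 e0.
by exists N => // n /= /HN; rewrite /series /= big_mkord.
Qed.

Lemma resolvent_closed_span (S : A -> Prop) x y : resolvent x y -> `|x| <= 2^-1 ->
  (forall n, closed_span S (bexp x n)) -> closed_span S y.
Proof.
move=> xy x2 Sx f ff fS; apply: norm_eq0_le => e e0.
have [N /(_ N (leqnn _))] := bfun_resolvent_le ff xy x2 e0.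
by rewrite big1 ?subr0 // => i _; apply: Sx.
Qed.

End Resolvents.

(** * Generating functions as resolvents, and local inversion of [psi] *)

Section Transforms.
Variables (K : numFieldType) (hK : halving K) (A : banachAlgType K) (phi : {scalar A}).
Hypotheses (phi_bd : bounded_functional phi) (phi1 : phi bone = 1).
Implicit Types (a b u v : A) (z w : K).

Lemma h_funE a z u : resolvent (z *: a) u -> `|z *: a| <= 2^-1 -> h_fun phi a z = phi u.
Proof.
move=> au az; rewrite -(bfun_resolvent_cvg hK phi_bd au az) /h_fun.
by congr (limn (series _)); apply/funext => n /=; rewrite bexpZ linearZ mulrC.
Qed.

(** The inner sum is the Neumann series of [v] under a functional with a power of [z *: a] fixed on
    the left; the outer one is that of [u] with [v] fixed on the right. *)
Lemma H_funE a b z w u v :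
  resolvent (z *: a) u -> `|z *: a| <= 2^-1 -> resolvent (w *: b) v -> `|w *: b| <= 2^-1 ->
  H_fun phi a b z w = phi (bmul u v).
Proof.
move=> au az bv bw.
rewrite -(bfun_resolvent_cvg hK (bfun_mulr v phi_bd) au az) /H_fun.
congr (limn (series _)); apply/funext => n /=.
rewrite -(bfun_resolvent_cvg hK (bfun_mull (bexp (z *: a) n) phi_bd) bv bw).
congr (limn (series _)); apply/funext => m /=.
by rewrite !bexpZ -bscalerAr -bscalerAl !linearZ /= ; ring.
Qed.

Lemma psi_funE a z u : resolvent (z *: a) u -> `|z *: a| <= 2^-1 -> psi_fun phi a z = phi u - 1.
Proof. by move=> au az; rewrite /psi_fun (h_funE au az). Qed.

Section LocalInverse.
Variables (a : A).
Hypothesis phia : phi a != 0.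
Let psi := psi_fun phi a.

(** The resolvent identity: [u - v] is [u] times [(1 - w a) - (1 - z a)] times [v]. *)
Lemma psi_diff z w u v :
  resolvent (z *: a) u -> `|z *: a| <= 2^-1 -> resolvent (w *: a) v -> `|w *: a| <= 2^-1 ->
  psi z - psi w = (z - w) * phi (bmul u (bmul a v)).
Proof.
move=> au az av aw; rewrite /psi (psi_funE au az) (psi_funE av aw).
rewrite opprB addrA subrK -linearB -linearZ; congr (phi _).
have [_ uz] := au; have [vw _] := av.
have -> : u - v = bmul u (bmul ((bone - w *: a) - (bone - z *: a)) v).
  by rewrite bmulBl bmulBr vw bmulr1 [bmul u (bmul _ v)]bmulA uz bmul1r.
by rewrite opprB addrC addrA subrK -scalerBl -bscalerAl -bscalerAr.
Qed.

Let B := `|bone : A|.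

(** Since [u] and [v] are within O(e) of [bone], the difference quotient [phi (u a v)] of [psi_diff]
    is within O(e) of [phi a]. This takes the place of differentiability. *)
Lemma psi_quotient : exists2 C, 0 <= C & forall e z w, `|z| <= e -> `|w| <= e ->
  e * `|a| <= 2^-1 ->
  exists2 q, psi z - psi w = (z - w) * (phi a * (1 - q)) & `|q| <= C * e.
Proof.
have [M M0 phiM] := phi_bd.2; have B0 : 0 <= B := normr_ge0 _.
exists (M * (2 * `|a| * B * `|a| * (2 * B) + `|a| * (2 * `|a| * B)) / `|phi a|).
  by rewrite !(divr_ge0, mulr_ge0, addr_ge0).
move=> e z w ze we ea.
have small x : `|x| <= e -> `|x *: a| <= 2^-1.
  by move=> xe; rewrite normrZ; apply: le_trans ea; rewrite ler_wpM2r.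
have [u au ub] := resolvent_exists hK (small z ze).
have [v av vb] := resolvent_exists hK (small w we).
have near1 x y : `|x| <= e -> resolvent (x *: a) y -> `|y| <= 2 * B -> `|y - bone| <= 2 * `|a| * B * e.
  move=> xe xy yb; rewrite {1}(resolventEl xy) addrAC subrr add0r.
  apply: le_trans (bnormM _ _) _; rewrite normrZ.
  apply: (@le_trans _ _ (e * `|a| * (2 * B))); last by rewrite le_eqVlt; apply/orP; left; apply/eqP; ring.
  by rewrite ler_pM // ?mulr_ge0 // ler_wpM2r.
exists ((phi a - phi (bmul u (bmul a v))) / phi a).
  rewrite (psi_diff au (small z ze) av (small w we)); congr (_ * _); field.
  exact: phia.
rewrite normrM normfV mulrAC ler_wpM2r ?invr_ge0 // -[leRHS]mulrA.
rewrite -linearB; apply: le_trans (phiM _) _; rewrite ler_wpM2l //.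
have -> : a - bmul u (bmul a v) = - (bmul (u - bone) (bmul a v) + bmul a (v - bone)).
  by rewrite bmulBl bmulBr bmul1r bmulr1 addrA subrK opprB.
rewrite normrN mulrDl; apply: le_trans (ler_normD _ _) _; apply: lerD.
  apply: le_trans (bnormM _ _) _.
  apply: (@le_trans _ _ (2 * `|a| * B * e * (`|a| * (2 * B)))).
    apply: ler_pM => //; first exact: near1 ze au ub.
    by apply: le_trans (bnormM _ _) _; rewrite ler_wpM2l.
  by rewrite le_eqVlt; apply/orP; left; apply/eqP; ring.
apply: le_trans (bnormM _ _) _; rewrite -[leRHS]mulrA ler_wpM2l //.
exact: near1 we av vb.
Qed.

Lemma psi0 : psi 0 = 0.
Proof.
have a0 : `|(0 : K) *: a| <= 2^-1 by rewrite scale0r normr0 invr_ge0.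
have r0 : resolvent ((0 : K) *: a) bone by rewrite scale0r; split; rewrite subr0 bmulr1.
by rewrite /psi (psi_funE r0 a0) phi1 subrr.
Qed.

(** A quantitative inverse function theorem. Injectivity follows from [|q| <= 1/2], surjectivity
    from a Newton iteration with constant slope [phi a]. *)
Lemma psi_local_inverse : exists C : K, exists2 d : K, 0 <= C /\ 0 < d &
  [/\ forall z w, `|z| <= d -> `|w| <= d -> psi z = psi w -> z = w,
      forall z, `|z| <= d -> `|psi z| <= C * `|z|
    & forall w, `|w| <= d -> exists2 z, psi z = w & `|z| <= C * `|w|].
Proof.
have [C0 C00 quot] := psi_quotient; have [M M0 phiM] := phi_bd.2.
have B0 : 0 <= B := normr_ge0 _; pose P : K := `|phi a|; have P0 : 0 < P by rewrite normr_gt0.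
have P_ge0 := ltW P0.
(* The three bounds give, in order, existence of the resolvents, injectivity, and contraction ratio
   1/2 for [T] below. *)
have [e e0 [ea eC eCM]] : exists2 e : K, 0 < e &
    [/\ e * `|a| <= 2^-1, C0 * e <= 2^-1 & M * (C0 * e * B) <= 2^-1].
  have [] := near0P (fun e : K => [/\ `|a| * `|e| <= 2^-1, C0 * `|e| <= 2^-1 & M * C0 * B * `|e| <= 2^-1]).
  have h0 : (0 : K) < 2^-1 by rewrite invr_gt0.
  case.
    near=> e; split; near: e; apply: near0_mul_le => //; by rewrite !mulr_ge0.
  move=> d d0 dP _; exists (d / 2); first by rewrite divr_gt0.
  have [|] := dP (d / 2).
    by rewrite gtr0_norm ?divr_gt0 // ltr_pdivrMr // ltr_pMr // ltr1n.
  rewrite gtr0_norm ?divr_gt0 // => h1 h2 h3; split=> //; first by rewrite mulrC.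
  by apply: le_trans h3; rewrite le_eqVlt; apply/orP; left; apply/eqP; ring.
have diff z w : `|z| <= e -> `|w| <= e ->
    exists2 q, psi z - psi w = (z - w) * (phi a * (1 - q)) & `|q| <= C0 * e.
  by move=> ze we; apply: quot.
(* Chosen so that [P / D <= 1] and [4 * B / D <= 1]: the first gives [d <= rho], the second
   [4 * |T 0| <= rho]. The radius [rho] is such that [phi] maps its ball into the ball of radius
   [e]. *)
pose D := 4 * (B + 1) * (P + 1).
have D0 : 0 < D by rewrite !mulr_gt0 ?ltr_wpDl // ltW.
have PD : P / D <= 1.
  rewrite ler_pdivrMr // mul1r /D; apply: (@le_trans _ _ (1 * (P + 1))).
    by rewrite mul1r lerDl.
  apply: ler_wpM2r; first by rewrite addr_ge0 // ltW.
  apply: (@le_trans _ _ (4 * 1)).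
    by rewrite mulr1 ler1n.
  by rewrite ler_wpM2l // lerDr.
have BD : 4 * B / D <= 1.
  rewrite ler_pdivrMr // mul1r /D; apply: (@le_trans _ _ (4 * (B + 1) * 1)).
    by rewrite mulr1 ler_wpM2l // lerDl.
  by rewrite ler_wpM2l ?lerDr ?mulr_ge0 ?addr_ge0 // ltW.
pose rho := e / (M + 1).
have M1 : 0 < M + 1 by rewrite ltr_wpDl.
have rho0 : 0 < rho by rewrite divr_gt0.
have rhoe : M * rho <= e.
  by rewrite mulrCA -[leRHS]mulr1 (ler_wpM2l (ltW e0)) // ler_pdivrMr // mul1r lerDl.
have rhoe1 : rho <= e by rewrite ler_pdivrMr // ler_peMr ?(ltW e0) // lerDr.
pose d := rho * (P / D).
have de : d <= e.
  by apply: le_trans rhoe1; rewrite -[leRHS]mulr1 ler_wpM2l // ltW.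
exists (2 * P + 2 * M * B / P), d.
  by split; [rewrite !(addr_ge0, mulr_ge0, invr_ge0) | rewrite mulr_gt0 ?divr_gt0].
split=> [z w zd wd|z zd|w wd].
- have [q qE qb] := diff z w (le_trans zd de) (le_trans wd de).
  move=> zw; apply/eqP; move/eqP: qE; rewrite zw subrr eq_sym.
  rewrite !mulf_eq0 (negbTE phia) !subr_eq0 /= => /orP[//|/eqP q1].
  have := le_trans qb eC; rewrite -q1 normr1.
  by rewrite invf_ge1 // lern1.
- have [|q qE qb] := diff z 0 (le_trans zd de); first by rewrite normr0 ltW.
  move: qE; rewrite psi0 !subr0 => ->; rewrite !normrM -/P.
  rewrite mulrC ler_wpM2r //.
  apply: (@le_trans _ _ (2 * P)); last by rewrite lerDl !(mulr_ge0, invr_ge0).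
  rewrite mulrC (ler_wpM2r (ltW P0)) //; apply: le_trans (ler_normB _ _) _.
  rewrite normr1 -[2]/(1 + 1) lerD2l; apply: le_trans qb _; apply: le_trans eC _.
  by rewrite invf_le1 // ler1n.
(* The Newton step [t - (psi t - w) / phi a] is carried out in the complete space [A], on scalars
   embedded as multiples of [bone] and read off by [phi]. *)
pose T (x : A) : A := (phi x - (psi (phi x) - w) / phi a) *: bone.
have T0E : T 0 = (w / phi a) *: bone.
  by rewrite /T linear0 psi0 !sub0r mulNr opprK.
have T0b : `|T 0| = `|w| * B / P by rewrite T0E normrZ normrM normfV mulrAC.
have [x Tx xb] : exists2 x, T x = x & `|x| <= 2 * `|T 0|.
  apply: (fixed_point hK (rho := rho)) => // [x y xr yr|]; last first.
    rewrite T0b; apply: (@le_trans _ _ (4 * (d * B / P))).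
      by rewrite ler_wpM2l // ler_wpM2r ?invr_ge0 ?(ltW P0) // ler_wpM2r.
    have -> : 4 * (d * B / P) = rho * (4 * B / D).
      by rewrite /d; field; rewrite !gt_eqF.
    by rewrite -[leRHS]mulr1 ler_wpM2l // ltW.
  have phie v : `|v| <= rho -> `|phi v| <= e.
    by move=> vr; apply: le_trans (phiM _) _; apply: le_trans rhoe; rewrite ler_wpM2l.
  have [q qE qb] := diff _ _ (phie x xr) (phie y yr).
  rewrite /T -scalerBl normrZ.
  have aux (s t p p' f : K) : f != 0 -> p - p' = (s - t) * (f * (1 - q)) ->
      s - (p - w) / f - (t - (p' - w) / f) = (s - t) * q.
    move=> f0 pE; have -> : p = p' + (s - t) * (f * (1 - q)) by rewrite -pE addrC subrK.
    by field.
  rewrite (aux _ _ _ _ _ phia qE) -linearB /=.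
  rewrite normrM; apply: (@le_trans _ _ (M * `|x - y| * (C0 * e) * B)).
    by rewrite ler_wpM2r // ler_pM.
  rewrite [leLHS](_ : _ = `|x - y| * (M * (C0 * e * B))); last by ring.
  by rewrite ler_wpM2l.
exists (phi x).
  have := congr1 phi Tx; rewrite /T linearZ /= phi1 mulr1 => /eqP.
  rewrite -subr_eq0 addrAC subrr add0r oppr_eq0 mulf_eq0 invr_eq0 (negbTE phia) orbF.
  by rewrite subr_eq0 => /eqP.
apply: le_trans (phiM _) _; apply: (@le_trans _ _ (M * (2 * (`|w| * B / P)))).
  by rewrite -T0b ler_wpM2l.
rewrite [leRHS]mulrDl [leLHS](_ : _ = 2 * M * B / P * `|w|); last by ring.
by rewrite lerDr !mulr_ge0 // ltW.
Unshelve. all: by end_near.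
Qed.

(** Choosing preimages shows that an inverse exists, but [X_fun] is whichever one [xget] selects.
    The bound still holds for it: a small [w] is [psi z] with [|z| <= C * |w|], and the left inverse
    property forces [X_fun phi a w = z]. *)
Lemma X_fun_compinv : is_compinv psi (X_fun phi a) /\
  exists2 C : K, 0 <= C & \forall z \near (0 : K), `|X_fun phi a z| <= C * `|z|.
Proof.
have [C [d [C0 d0] [inj psiC surj]]] := psi_local_inverse.
have Cd e : 0 < e -> \forall w \near (0 : K), C * `|w| <= e by apply: near0_mul_le.
have dn : \forall w \near (0 : K), `|w| <= d.
  by apply/near0P; exists d => // w /ltW.
have [g gP] : exists g : K -> K, forall w, `|w| <= d -> psi (g w) = w /\ `|g w| <= C * `|w|.
  have /choice[g gP] : forall w, exists z, `|w| <= d -> psi z = w /\ `|z| <= C * `|w|.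
    move=> w; have [wd|_] := boolP (`|w| <= d); last by exists 0.
    by have [z zw zC] := surj w wd; exists z.
  by exists g.
have inv : is_compinv psi (X_fun phi a).
  apply: (@xgetPex _ _ [set g | is_compinv psi g]); exists g; split; last first.
    by near=> w; have [] // := gP w; near: w.
  near=> z.
  have zd : `|z| <= d by near: z.
  have Czd : C * `|z| <= d by near: z; apply: Cd.
  have CCzd : C * (C * `|z|) <= d.
    by rewrite mulrA; near: z; apply: near0_mul_le; rewrite ?mulr_ge0.
  have pd : `|psi z| <= d by apply: le_trans (psiC z zd) Czd.
  have [gz gC] := gP _ pd; apply: inj => //.
  by apply: le_trans gC _; apply: le_trans CCzd; rewrite ler_wpM2l // psiC.
split=> //; have [/near0P[r r0 Xpsi] psiX] := inv; exists C => //; near=> w.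
have [|z zw zC] := surj w; first by near: w.
rewrite -{1}zw Xpsi //; apply: le_lt_trans zC _.
apply: le_lt_trans (_ : r / 2 < r).
  by near: w; apply: Cd; rewrite divr_gt0.
by rewrite ltr_pdivrMr // ltr_pMr // ltr1n.
Unshelve. all: by end_near.
Qed.

End LocalInverse.
End Transforms.

(** * Factorization of the resolvents *)

Section ClosedSpans.
Variables (K : numFieldType) (hK : halving K) (A : banachAlgType K) (phi : {scalar A}).
Hypotheses (phi_bd : bounded_functional phi) (phi1 : phi bone = 1).
Implicit Types (c : bool -> A) (e : bool) (S : A -> Prop) (x y X Y : A) (k : K).

Lemma bfun_scale (f : A -> K) k : bounded_functional f -> bounded_functional (fun x => k * f x).
Proof.
move=> ff; split=> [l x y|]; first by rewrite ff.1; ring.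
have [M M0 fM] := ff.2; exists (`|k| * M); first by rewrite mulr_ge0.
by move=> x; rewrite normrM -mulrA ler_wpM2l.
Qed.

Lemma closed_spanZ S k x : closed_span S x -> closed_span S (k *: x).
Proof. by move=> Sx f ff fS; rewrite bfunZ // Sx // mulr0. Qed.

(** The closed unital subalgebra generated by [c e]. *)
Definition alg c e : A -> Prop := closed_span (fun y => exists n, y = bexp (c e) n).

Definition alternating c e : A -> Prop := closed_span (fun y => exists ns, y = alt phi c e ns).

Lemma alg1 c e : alg c e bone.
Proof. by apply: mem_closed_span; exists 0%N. Qed.

Lemma alg_gen c e : alg c e (c e).
Proof. by apply: mem_closed_span; exists 1%N; rewrite /= bmulr1. Qed.

Lemma alg_recenter c e x : alg c e x -> alg c e (recenter phi x).
Proof.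
move=> cx; rewrite /recenter addrC -scaleNr.
by apply: closed_span_lin => //; apply: alg1.
Qed.

Lemma alg_resolvent c e k x : resolvent (k *: c e) x -> `|k *: c e| <= 2^-1 -> alg c e x.
Proof.
move=> cx ck; apply: (resolvent_closed_span hK cx ck) => n.
by rewrite bexpZ; apply/closed_spanZ/mem_closed_span; exists n.
Qed.

Lemma phi_recenter x : phi (recenter phi x) = 0.
Proof. by rewrite /recenter linearB linearZ /= phi1 mulr1 subrr. Qed.

Lemma alternating1 c e : alternating c e bone.
Proof. by apply: mem_closed_span; exists [::]. Qed.

(** On generators this is the recursion of [alt]; it extends to the closed spans in [X] first and
    then in [x]. *)
Lemma alternatingM c e X x : alternating c e X -> alg c e x ->
  alternating c (~~ e) (bmul X (recenter phi x)).
Proof.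
move=> cX cx f ff fS.
apply: (cX (fun X => f (bmul X (recenter phi x)))); first exact: bfun_mulr.
move=> _ [ns ->].
have centerE y : f (bmul (alt phi c e ns) (recenter phi y)) =
    f (bmul (alt phi c e ns) y) - f (alt phi c e ns) * phi y.
  by rewrite /recenter bmulBr bfunB // -bscalerAr bmulr1 bfunZ // [phi y * _]mulrC.
rewrite centerE; apply: (cx (fun y => f (bmul (alt phi c e ns) y) - f (alt phi c e ns) * phi y)).
  by apply: bfun_lin => //; apply: bfun_mull.
by move=> _ [n ->]; rewrite -centerE fS //; exists (n :: ns); rewrite /= negbK.
Qed.

Lemma alternating_resolvent c e k x y N : alg c e x -> alg c (~~ e) y ->
  resolvent (k *: bmul (recenter phi x) (recenter phi y)) N ->
  `|k *: bmul (recenter phi x) (recenter phi y)| <= 2^-1 -> alternating c e N.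
Proof.
move=> cx cy cN ck; apply: (resolvent_closed_span hK cN ck); elim=> [|n IH].
  exact: alternating1.
rewrite bexpSr -bscalerAr bmulA; apply: closed_spanZ.
by have := alternatingM (alternatingM IH cx) cy; rewrite negbK.
Qed.

Lemma resolvent_swap k x y N N' :
  resolvent (k *: bmul x y) N -> resolvent (k *: bmul y x) N' -> bmul y N = bmul N' y.
Proof.
move=> [xyN _] [_ yxN].
rewrite -[bmul y N]bmul1r -yxN -bmulA; congr (bmul _ _).
transitivity (bmul y (bmul (bone - k *: bmul x y) N)); last by rewrite xyN bmulr1.
by rewrite !bmulBl !bmul1r bmulBr -!bscalerAl -bscalerAr !bmulA.
Qed.

(** Only a right inverse is produced; [resolvent_uniq] identifies it with the resolvent once the
    latter is known to exist. *)
Lemma haagerup (c1 c2 u v N : A) (x1 x2 z : K) : z != 0 -> 1 + z != 0 ->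
  resolvent (x1 *: c1) u -> resolvent (x2 *: c2) v ->
  phi u = 1 + z -> phi v = 1 + z ->
  resolvent ((z * (1 + z))^-1 *: bmul (recenter phi u) (recenter phi v)) N ->
  bmul (bone - (x1 * x2 * (1 + z) / z) *: bmul c1 c2)
       ((1 + z)^-1 *: bmul (bmul v N) u) = bone.
Proof.
move=> z0 al0 cu cv pu pv [RN _]; set al := 1 + z in al0 pu pv RN *.
set s := x1 * x2 * al / z.
have [cu1 cu2] := cu; have [cv1 cv2] := cv.
have uv : bmul (bmul u (bone - s *: bmul c1 c2)) v =
    al *: (bone - (z * al)^-1 *: bmul (recenter phi u) (recenter phi v)).
  have uE : bmul u (x1 *: c1) = u - bone by rewrite {2}(resolventEr cu) addrAC subrr add0r.
  have vE : bmul (x2 *: c2) v = v - bone by rewrite {2}(resolventEl cv) addrAC subrr add0r.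
  (* By [uE] and [vE], [x1 u c1 = u - 1] and [x2 c2 v = v - 1], which eliminates [c1] and [c2]. *)
  have -> : bmul (bmul u (bone - s *: bmul c1 c2)) v =
      bmul u v - (al / z) *: bmul (u - bone) (v - bone).
    rewrite bmulBr bmulBl bmulr1 -uE -vE; congr (_ - _).
    rewrite -!bscalerAr -!bscalerAl -!bscalerAr !scalerA !bmulA; congr (_ *: _).
    by rewrite /s; field.
  rewrite /recenter pu pv !(bmulBl, bmulBr) -!bscalerAl -!bscalerAr !bmul1r !bmulr1.
  rewrite !(scalerBr, scalerA, opprB, opprD).
  have -> : al / (z * al) * al = al / z by field; rewrite z0 al0.
  have -> : al / (z * al) * (al * al) = al / z + al by rewrite /al; field; rewrite z0 al0.
  have -> : al / (z * al) = z^-1 by field; rewrite z0 al0.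
  have {4}-> : al / z = 1 + z^-1 by rewrite /al; field.
  have rearrange (V : zmodType) (p q r t d e : V) :
      p + (q - r + (t - (p + d))) = e + (q - (r + e) + (t - d)).
    transitivity (q - r + (t - d)).
      have -> : t - (p + d) = t - d - p by rewrite opprD addrA addrAC.
      by rewrite addrCA [p + _]addrC subrK.
    by rewrite opprD [q + (- r - e)]addrA [RHS]addrA [e + _]addrC subrK.
  rewrite [(1 + z^-1) *: _]scalerDl scale1r [(al / z + al) *: _]scalerDl; exact: rearrange.
rewrite -bscalerAr.
have -> : bmul (bone - s *: bmul c1 c2) (bmul (bmul v N) u) = al *: bone.
  (* The identity [(1 - x1 c1) u = 1] is used twice: here to insert [u], and at the end to cancel
     the last [u]. *)
  transitivity (bmul (bone - x1 *: c1)
      (bmul (bmul (bmul (bmul u (bone - s *: bmul c1 c2)) v) N) u)).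
    by rewrite !bmulA cu1 bmul1r.
  by rewrite uv -bscalerAl RN -bscalerAl bmul1r -bscalerAr cu1.
by rewrite scalerA mulVf // scale1r.
Qed.

End ClosedSpans.

Arguments alg1 {K A} c e.
Arguments alg_gen {K A} c e.
Arguments alternating1 {K A} phi c e.
Arguments phi_recenter {K A phi}.

(** * Pairings of left and right alternating elements *)

Section Pairings.
Variables (K : numFieldType) (hK : halving K) (A : banachAlgType K) (phi : {scalar A}).
Hypotheses (phi_bd : bounded_functional phi) (phi1 : phi bone = 1).
Variables (a b : bool -> A).
Hypothesis bf : bifree phi (a false) (b false) (a true) (b true).
Implicit Types (e : bool) (X Y x y : A).

(** Both sides are bounded and linear in each argument, so [phi_alt_powers] extends to the closed
    spans one argument at a time. *)
Lemma phi_free e X Y x y :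
  alternating phi a e X -> alternating phi b e Y -> alg a e x -> alg b e y ->
  phi (bmul (bmul X x) (bmul Y y)) = phi (bmul x y) * phi (bmul X Y).
Proof.
move=> aX bY ax byy.
have H1 nL nR n : phi (bmul (bmul (alt phi a e nL) (bexp (a e) n)) (bmul (alt phi b e nR) y)) =
    phi (bmul (alt phi a e nL) (alt phi b e nR)) * phi (bmul (bexp (a e) n) y).
  apply: (closed_span_eq (f := fun y => phi (bmul (bmul _ _) (bmul _ y)))
    (g := fun y => _ * phi (bmul _ y)) _ _ _ byy).
  - by apply: (bfun_mull _ (f := fun y => phi (bmul _ y))); apply: bfun_mull.
  - by apply: bfun_scale; apply: bfun_mull.
  - by move=> _ [m ->]; rewrite phi_alt_powers // mulrC.
have H2 nL nR : phi (bmul (bmul (alt phi a e nL) x) (bmul (alt phi b e nR) y)) =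
    phi (bmul (alt phi a e nL) (alt phi b e nR)) * phi (bmul x y).
  apply: (closed_span_eq (f := fun x => phi (bmul (bmul _ x) (bmul _ _)))
    (g := fun x => _ * phi (bmul x _)) _ _ _ ax).
  - by apply: (bfun_mull _ (f := fun y => phi (bmul y _))); apply: bfun_mulr.
  - by apply: bfun_scale; apply: bfun_mulr.
  - by move=> _ [n ->]; apply: H1.
have H3 nL : phi (bmul (bmul (alt phi a e nL) x) (bmul Y y)) =
    phi (bmul x y) * phi (bmul (alt phi a e nL) Y).
  apply: (closed_span_eq (f := fun Y => phi (bmul (bmul _ _) (bmul Y _)))
    (g := fun Y => _ * phi (bmul _ Y)) _ _ _ bY).
  - by apply: (bfun_mulr _ (f := fun y => phi (bmul _ y))); apply: bfun_mull.
  - by apply: bfun_scale; apply: bfun_mull.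
  - by move=> _ [nR ->]; rewrite H2 mulrC.
apply: (closed_span_eq (f := fun X => phi (bmul (bmul X _) (bmul _ _)))
    (g := fun X => _ * phi (bmul X _)) _ _ _ aX).
- by apply: (bfun_mulr _ (f := fun y => phi (bmul y _))); apply: bfun_mulr.
- by apply: bfun_scale; apply: bfun_mulr.
- by move=> _ [nL ->]; apply: H3.
Qed.

(** Trivial right factors reduce the pairing formula to freeness of the left variables; [phi_freer]
    is its mirror image. *)
Lemma phi_freel e X x : alternating phi a e X -> alg a e x -> phi (bmul X x) = phi X * phi x.
Proof.
move=> aX ax; have := phi_free aX (alternating1 phi b e) ax (alg1 b e).
by rewrite !bmulr1 mulrC.
Qed.

Lemma phi_freer e Y y : alternating phi b e Y -> alg b e y -> phi (bmul Y y) = phi Y * phi y.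
Proof.
move=> bY byy; have := phi_free (alternating1 phi a e) bY (alg1 a e) byy.
by rewrite !bmul1r mulrC.
Qed.

Variables (x y : bool -> A).
Hypotheses (ax : forall e, alg a e (x e)) (byy : forall e, alg b e (y e)).
Let x0 e := recenter phi (x e).
Let y0 e := recenter phi (y e).
Let cov e := phi (bmul (x0 e) (y0 e)).

Lemma pair_both e X Y : alternating phi a e X -> alternating phi b e Y ->
  phi (bmul (bmul X (x0 e)) (bmul Y (y0 e))) = cov e * phi (bmul X Y).
Proof.
move=> aX bY; exact: (phi_free aX bY (alg_recenter phi (@ax e)) (alg_recenter phi (@byy e))).
Qed.

Lemma pair_left e X Y : alternating phi a e X -> alternating phi b e Y ->
  phi (bmul (bmul X (x0 e)) Y) = 0.
Proof.
move=> aX bY; have := phi_free aX bY (alg_recenter phi (@ax e)) (alg1 b e).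
by rewrite !bmulr1 phi_recenter // mul0r.
Qed.

Lemma pair_right e X Y : alternating phi a e X -> alternating phi b e Y ->
  phi (bmul X (bmul Y (y0 e))) = 0.
Proof.
move=> aX bY; have := phi_free aX bY (alg1 a e) (alg_recenter phi (@byy e)).
by rewrite bmulr1 bmul1r phi_recenter // mul0r.
Qed.

Lemma phi_dl (k : K) (P Q Y : A) : phi (bmul (P + k *: Q) Y) = phi (bmul P Y) + k * phi (bmul Q Y).
Proof. by rewrite bmulDl linearD -bscalerAl linearZ. Qed.

Lemma phi_dr (k : K) (P Q Y : A) : phi (bmul Y (P + k *: Q)) = phi (bmul Y P) + k * phi (bmul Y Q).
Proof. by rewrite bmulDr linearD -bscalerAr linearZ. Qed.

Lemma affine_mul (k : K) (U V N : A) :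
  bmul (bmul (V + k *: bone) N) (U + k *: bone) =
  bmul (bmul V N) U + k *: bmul V N + k *: bmul N U + k ^+ 2 *: N.
Proof.
rewrite bmulDl !bmulDr !bmulDl -!bscalerAl -!bscalerAr !bmul1r !bmulr1 scalerA expr2.
by rewrite -!addrA; congr (_ + _); rewrite addrCA.
Qed.

(* N and Nt generate the alternating words in x0 whose length is even; the four
   products N, N x0, x0 N, x0 N x0 are sorted by their first and last factor,
   and a pairing vanishes unless lengths and colours match from the inside. *)
Lemma pairing_value (zeta om al be : K) (N Nt N' Nt' : A) :
  resolvent (zeta *: bmul (x0 false) (x0 true)) N ->
  `|zeta *: bmul (x0 false) (x0 true)| <= 2^-1 ->
  resolvent (zeta *: bmul (x0 true) (x0 false)) Nt ->
  `|zeta *: bmul (x0 true) (x0 false)| <= 2^-1 ->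
  resolvent (om *: bmul (y0 true) (y0 false)) N' ->
  `|om *: bmul (y0 true) (y0 false)| <= 2^-1 ->
  resolvent (om *: bmul (y0 false) (y0 true)) Nt' ->
  `|om *: bmul (y0 false) (y0 true)| <= 2^-1 ->
  phi (x true) = al -> phi (x false) = al -> phi (y true) = be -> phi (y false) = be ->
  zeta * om * (cov false * cov true) != 1 ->
  phi (bmul (bmul (bmul (x true) N) (x false)) (bmul (bmul (y false) N') (y true))) =
  al ^+ 2 * be ^+ 2 +
  (al * be * (cov false + cov true) +
    (al ^+ 2 * zeta + be ^+ 2 * om) * (cov false * cov true)) /
  (1 - zeta * om * (cov false * cov true)).
Proof.
move=> rN bN rNt bNt rN' bN' rNt' bNt' xT xF yT yF det.
set p := cov false in det *; set q := cov true in det *.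
have aN : alternating phi a false N := alternating_resolvent hK phi_bd (@ax false) (@ax true) rN bN.
have aNt : alternating phi a true Nt :=
  alternating_resolvent hK phi_bd (@ax true) (@ax false) rNt bNt.
have bN'a : alternating phi b true N' :=
  alternating_resolvent hK phi_bd (@byy true) (@byy false) rN' bN'.
have bNt'a : alternating phi b false Nt' :=
  alternating_resolvent hK phi_bd (@byy false) (@byy true) rNt' bNt'.
pose L2 := bmul N (x0 false); pose L3 := bmul Nt (x0 true); pose L4 := bmul L3 (x0 false).
pose R2 := bmul N' (y0 true); pose R3 := bmul Nt' (y0 false); pose R4 := bmul R3 (y0 true).
have aL2 : alternating phi a true L2 by apply: (alternatingM phi_bd aN (@ax false)).
have aL3 : alternating phi a false L3 by apply: (alternatingM phi_bd aNt (@ax true)).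
have aL4 : alternating phi a true L4 by apply: (alternatingM phi_bd aL3 (@ax false)).
have bR2 : alternating phi b false R2 by apply: (alternatingM phi_bd bN'a (@byy true)).
have bR3 : alternating phi b true R3 by apply: (alternatingM phi_bd bNt'a (@byy false)).
have bR4 : alternating phi b false R4 by apply: (alternatingM phi_bd bR3 (@byy true)).
have a1 e : alternating phi a e bone := alternating1 phi a e.
have b1 e : alternating phi b e bone := alternating1 phi b e.
have NE : N = bone + zeta *: bmul L2 (x0 true).
  by rewrite {1}(resolventEr rN) -bscalerAr bmulA.
have NtE : Nt = bone + zeta *: bmul L3 (x0 false).
  by rewrite {1}(resolventEr rNt) -bscalerAr bmulA.
have N'E : N' = bone + om *: bmul R2 (y0 false).
  by rewrite {1}(resolventEr rN') -bscalerAr bmulA.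
have Nt'E : Nt' = bone + om *: bmul R3 (y0 true).
  by rewrite {1}(resolventEr rNt') -bscalerAr bmulA.
have L3E : L3 = bmul (x0 true) N by rewrite /L3 -(resolvent_swap rN rNt).
have R3E : R3 = bmul (y0 false) N' by rewrite /R3 -(resolvent_swap rN' rNt').
have det0 : 1 - zeta * om * (p * q) != 0 by rewrite subr_eq0 eq_sym.
(* Stripping matching last factors twice leads back to the same pairing, multiplied by
   [zeta * om * (p * q)]; as this is not 1, such a pairing is 0, or [g] when a constant term 1
   remains. *)
have solve0 t : t = zeta * om * (p * q) * t -> t = 0.
  move=> tE; apply: (mulfI det0); rewrite mulr0 mulrBl mul1r -tE subrr //.
set g := (1 - zeta * om * (p * q))^-1.
have solve1 t : t = 1 + zeta * om * (p * q) * t -> t = g.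
  move=> tE; apply: (mulfI det0); rewrite mulfV // mulrBl mul1r {1}tE addrK //.
pose Bf X Y := phi (bmul X Y).
have B11 : Bf N N' = 1.
  rewrite /Bf {1}NE phi_dl (pair_left (e := true)) // mulr0 addr0.
  by rewrite N'E phi_dr (pair_right (e := false)) // mulr0 addr0 bmulr1.
have B21 : Bf L2 N' = om * p * Bf N R2.
  rewrite /Bf {1}N'E phi_dr (pair_left (e := false)) // add0r /L2.
  by rewrite (pair_both (e := false)) // mulrA.
have B12 : Bf N R2 = zeta * q * Bf L2 N'.
  rewrite /Bf {1}NE phi_dl (pair_right (e := true)) // add0r.
  by rewrite (pair_both (e := true)) // mulrA.
have B12_0 : Bf N R2 = 0 by apply: solve0; rewrite {1}B12 B21; ring.
have B13 : Bf N R3 = 0 by apply: (pair_right (e := false)).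
have B24 : Bf L2 R3 = p * Bf N Nt' by apply: (pair_both (e := false)).
have B14 : Bf N R4 = zeta * q * Bf L2 R3.
  rewrite /Bf {1}NE phi_dl (pair_right (e := true)) // add0r.
  by rewrite (pair_both (e := true)) // mulrA.
have BNNt' : Bf N Nt' = g.
  apply: solve1; rewrite {1}/Bf {1}Nt'E phi_dr -/(Bf N R4) B14 B24.
  rewrite {1}NE phi_dl (pair_left (e := true)) // mulr0 addr0 bmulr1 phi1.
  by ring.
have B22 : Bf L2 R2 = 0 by apply: (pair_left (e := false)).
have B24' : Bf L2 R4 = 0 by apply: (pair_left (e := false)).
have B31 : Bf L3 N' = 0 by apply: (pair_left (e := true)).
have B32 : Bf L3 R2 = q * Bf Nt N' by apply: (pair_both (e := true)).
have BNtN' : Bf Nt N' = g.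
  have B1 : phi (bmul Nt bone) = 1.
    by rewrite {1}NtE phi_dl (pair_left (e := false)) // mulr0 addr0 bmulr1.
  apply: solve1; rewrite {1}/Bf {1}N'E phi_dr B1 {1}NtE phi_dl (pair_right (e := false)) //.
  by rewrite (pair_both (e := false)) // -/(Bf L3 R2) B32 -/p; ring.
have B33 : Bf L3 R3 = 0 by apply: (pair_left (e := true)).
have BL3Nt' : Bf L3 Nt' = om * Bf L3 R4.
  by rewrite /Bf {1}Nt'E phi_dr (pair_left (e := true)) // add0r.
have B34 : Bf L3 R4 = 0.
  apply: solve0; rewrite {1}[Bf _ _](pair_both (e := true)) // -/q.
  rewrite {1}NtE phi_dl (pair_right (e := false)) // (pair_both (e := false)) //.
  by rewrite -/(Bf L3 Nt') BL3Nt' -/p; ring.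
have B41 : Bf L4 N' = om * p * Bf L3 R2.
  rewrite /Bf {1}N'E phi_dr (pair_left (e := false)) // add0r.
  by rewrite (pair_both (e := false)) // mulrA.
have B42 : Bf L4 R2 = 0 by apply: (pair_left (e := false)).
have B43 : Bf L4 R3 = 0.
  by rewrite [Bf _ _](pair_both (e := false)) // -/(Bf L3 Nt') BL3Nt' B34 !mulr0.
have B44 : Bf L4 R4 = 0 by apply: (pair_left (e := false)).
have xE e : x e = x0 e + phi (x e) *: bone by rewrite subrK.
have yE e : y e = y0 e + phi (y e) *: bone by rewrite subrK.
(* Splitting off the expectations turns the value into a sum of sixteen pairings, of which five
   survive: [N] with [N'] and [R4], [L2] with [R3], [L3] with [R2], [L4] with [N']. *)
have -> : bmul (bmul (x true) N) (x false) = L4 + al *: L3 + al *: L2 + al ^+ 2 *: N.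
  by rewrite [x true]xE [x false]xE xT xF affine_mul /L4 L3E.
have -> : bmul (bmul (y false) N') (y true) = R4 + be *: R3 + be *: R2 + be ^+ 2 *: N'.
  by rewrite [y false]yE [y true]yE yT yF affine_mul /R4 R3E.
rewrite !phi_dl !phi_dr -!/(Bf _ _).
rewrite B44 B43 B42 B41 B34 B33 B32 B31 B24' B24 B22 B21 B14 B13 B12_0 B11.
rewrite B24 BNNt' BNtN' -/g; ring.
Qed.

End Pairings.

(** * Haagerup's factorization for one side and small [z] *)

Section OneSide.
Variables (K : numFieldType) (hK : halving K) (A : banachAlgType K) (phi : {scalar A}).
Hypotheses (phi_bd : bounded_functional phi) (phi1 : phi bone = 1).
Variables (c : bool -> A) (e : bool).
Hypothesis free_c : forall e X x, alternating phi c e X -> alg c e x ->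
  phi (bmul X x) = phi X * phi x.
Hypothesis phic : forall e, phi (c e) != 0.

Local Notation Xf := (X_fun phi).

(* The resolvents that enter Haagerup's factorization at the point z. *)
Definition factors (M z : K) (u v N Nt : A) : Prop :=
  let u0 := recenter phi u in let v0 := recenter phi v in
  let zeta := (z * (1 + z))^-1 in
  [/\ 1 + z != 0,
      [/\ resolvent (Xf (c e) z *: c e) u, `|Xf (c e) z *: c e| <= 2^-1 & phi u = 1 + z],
      [/\ resolvent (Xf (c (~~ e)) z *: c (~~ e)) v,
          `|Xf (c (~~ e)) z *: c (~~ e)| <= 2^-1 & phi v = 1 + z],
      [/\ resolvent (zeta *: bmul u0 v0) N, `|zeta *: bmul u0 v0| <= 2^-1,
          resolvent (zeta *: bmul v0 u0) Nt, `|zeta *: bmul v0 u0| <= 2^-1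
        & M * (`|zeta| * (`|u0| * `|v0|)) <= 2^-1]
    & let d := bmul (c e) (c (~~ e)) in
      resolvent (Xf d z *: d) ((1 + z)^-1 *: bmul (bmul v N) u) /\ `|Xf d z *: d| <= 2^-1].

Lemma phi_product_neq0 : phi (bmul (c e) (c (~~ e))) != 0.
Proof.
have := free_c (alternatingM phi_bd (alternating1 phi c e) (alg_gen c e)) (alg_gen c (~~ e)).
rewrite bmul1r phi_recenter // mul0r /recenter bmulBl linearB -bscalerAl linearZ /= bmul1r.
by move=> /eqP; rewrite subr_eq0 => /eqP ->; rewrite mulf_neq0.
Qed.

(** Freeness kills the words with a centered last factor, so [N] contributes 1 and [v] and [u]
    contribute their expectations. This yields the value of [phi] at the resolvent of the
    product. *)
Lemma phi_factors (k : K) (u v N Nt : A) :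
  alg c e u -> alg c (~~ e) v ->
  resolvent (k *: bmul (recenter phi u) (recenter phi v)) N ->
  `|k *: bmul (recenter phi u) (recenter phi v)| <= 2^-1 ->
  resolvent (k *: bmul (recenter phi v) (recenter phi u)) Nt ->
  `|k *: bmul (recenter phi v) (recenter phi u)| <= 2^-1 ->
  phi (bmul (bmul v N) u) = phi u * phi v.
Proof.
move=> cu cv rN bN rNt bNt.
have aN := alternating_resolvent hK phi_bd cu cv rN bN.
have aNt : alternating phi c (~~ e) Nt.
  by apply: (alternating_resolvent hK phi_bd cv _ rNt bNt); rewrite negbK.
have aM d Y y : alternating phi c d Y -> alg c d y -> phi (bmul Y (recenter phi y)) = 0.
  by move=> aY cy; rewrite (free_c aY (alg_recenter phi cy)) phi_recenter // mulr0.
have vN : bmul (recenter phi v) N = bmul Nt (recenter phi v) := resolvent_swap rN rNt.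
have aL3 : alternating phi c e (bmul Nt (recenter phi v)).
  by have := alternatingM phi_bd aNt cv; rewrite negbK.
have phiN : phi N = 1.
  rewrite (resolventEr rN) linearD phi1 -bscalerAr linearZ /= bmulA.
  by rewrite (aM _ _ _ (alternatingM phi_bd aN cu) cv) mulr0 addr0.
have vE : v = recenter phi v + phi v *: bone by rewrite subrK.
have phivN : phi (bmul v N) = phi v.
  rewrite {1}vE bmulDl linearD -bscalerAl linearZ /= bmul1r phiN mulr1.
  by rewrite vN (aM _ _ _ aNt cv) add0r.
have avN : alternating phi c e (bmul v N).
  by rewrite vE bmulDl addrC -bscalerAl bmul1r vN; apply: closed_span_lin.
by rewrite (free_c avN cu) phivN mulrC.
Qed.

Let B := `|bone : A|.

(** The constant term of [u = 1 + k d u] disappears on recentering, so the recentered resolvent is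
    O(k). *)
Lemma norm_recenter_resolvent (M k : K) (d u : A) : 0 <= M -> (forall x, `|phi x| <= M * `|x|) ->
  resolvent (k *: d) u -> `|u| <= 2 * B -> `|recenter phi u| <= (1 + M * B) * (2 * B) * `|d| * `|k|.
Proof.
move=> M0 phiM ku ub.
have -> : recenter phi u = recenter phi (bmul (k *: d) u).
  rewrite /recenter {1 2}(resolventEl ku) linearD phi1 scalerDl scale1r.
  by rewrite opprD addrACA subrr add0r.
rewrite /recenter; apply: le_trans (ler_normB _ _) _; rewrite normrZ.
apply: (@le_trans _ _ ((1 + M * B) * `|bmul (k *: d) u|)).
  by rewrite mulrDl mul1r lerD2l mulrAC ler_wpM2r.
have B0 : 0 <= B := normr_ge0 _.
rewrite [leRHS](_ : _ = (1 + M * B) * (`|k| * `|d| * (2 * B))); last by ring.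
apply: ler_wpM2l; first by rewrite addr_ge0 ?mulr_ge0.
apply: le_trans (bnormM _ _) _; rewrite normrZ.
by rewrite ler_wpM2l ?mulr_ge0.
Qed.

(** Each smallness condition reduces to a constant times [|z|]. [M] will be a bound for [phi], and
    its clause in [factors] later keeps [zeta * om * (p * q)] away from 1. *)
Lemma factors_exist (M : K) : 0 <= M ->
  \forall z \near (0 : K), z != 0 -> exists u v N Nt, factors M z u v N Nt.
Proof.
move=> M0; have [Mp Mp0 phiM] := phi_bd.2.
have B0 : 0 <= B := normr_ge0 _.
set d := bmul (c e) (c (~~ e)).
have [[_ /near0P[r1 r10 inv1]] [C1 C10 XC1]] := X_fun_compinv hK phi_bd phi1 (phic e).
have [[_ /near0P[r2 r20 inv2]] [C2 C20 XC2]] := X_fun_compinv hK phi_bd phi1 (phic (~~ e)).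
have [[/near0P[r r0 invd] _] _] := X_fun_compinv hK phi_bd phi1 phi_product_neq0.
pose D1 := (1 + Mp * B) * (2 * B) * `|c e| * C1.
pose D2 := (1 + Mp * B) * (2 * B) * `|c (~~ e)| * C2.
have D10 : 0 <= D1 by rewrite !(mulr_ge0, addr_ge0).
have D20 : 0 <= D2 by rewrite !(mulr_ge0, addr_ge0).
have h0 : (0 : K) < 2^-1 by rewrite invr_gt0.
near=> z; move=> z0.
have nz0 : 0 < `|z| by rewrite normr_gt0.
have z2 : `|z| <= 2^-1 by rewrite -[leLHS]mul1r; near: z; apply: near0_mul_le.
have al_ge : 2^-1 <= `|1 + z|.
  rewrite -(lerD2r `|z|); apply: (@le_trans _ _ 1).
    by rewrite [leRHS](splitr 1) !mul1r lerD2l.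
  by have := ler_normB (1 + z) z; rewrite addrK normr1.
have al_le : `|1 + z| <= 2.
  apply: le_trans (ler_normD _ _) _; rewrite normr1 -[2]/(1 + 1) lerD2l.
  by apply: le_trans z2 _; rewrite invf_le1 // ler1n.
have al0 : 1 + z != 0 by rewrite -normr_gt0; apply: lt_le_trans al_ge.
have X1 : `|Xf (c e) z| <= C1 * `|z| by near: z.
have X2 : `|Xf (c (~~ e)) z| <= C2 * `|z| by near: z.
have p1 : psi_fun phi (c e) (Xf (c e) z) = z.
  by apply: inv1; near: z; apply/near0P; exists r1.
have p2 : psi_fun phi (c (~~ e)) (Xf (c (~~ e)) z) = z.
  by apply: inv2; near: z; apply/near0P; exists r2.
have small1 : `|Xf (c e) z *: c e| <= 2^-1.
  rewrite normrZ; apply: (@le_trans _ _ (`|c e| * C1 * `|z|)).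
    by rewrite mulrC -mulrA ler_wpM2l.
  by near: z; apply: near0_mul_le; rewrite ?mulr_ge0.
have small2 : `|Xf (c (~~ e)) z *: c (~~ e)| <= 2^-1.
  rewrite normrZ; apply: (@le_trans _ _ (`|c (~~ e)| * C2 * `|z|)).
    by rewrite mulrC -mulrA ler_wpM2l.
  by near: z; apply: near0_mul_le; rewrite ?mulr_ge0.
have [u cu ub] := resolvent_exists hK small1.
have [v cv vb] := resolvent_exists hK small2.
have phiu : phi u = 1 + z by rewrite -p1 (psi_funE hK phi_bd cu small1) addrC subrK.
have phiv : phi v = 1 + z by rewrite -p2 (psi_funE hK phi_bd cv small2) addrC subrK.
pose zeta := (z * (1 + z))^-1.
have u0b : `|recenter phi u| <= D1 * `|z|.
  apply: le_trans (norm_recenter_resolvent Mp0 phiM cu ub) _; rewrite /D1 -[leRHS]mulrA.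
  by rewrite ler_wpM2l // !(mulr_ge0, addr_ge0).
have v0b : `|recenter phi v| <= D2 * `|z|.
  apply: le_trans (norm_recenter_resolvent Mp0 phiM cv vb) _; rewrite /D2 -[leRHS]mulrA.
  by rewrite ler_wpM2l // !(mulr_ge0, addr_ge0).
have zeta_le : `|zeta| <= 2 / `|z|.
  rewrite /zeta invfM normrM !normfV mulrC ler_wpM2r ?invr_ge0 //.
  by rewrite -[2]invrK lef_pV2 ?posrE // (lt_le_trans h0).
(* The pole of [zeta] at 0 costs one power of [|z|], but the two recentered resolvents supply
   two. *)
have zuv : `|zeta| * (`|recenter phi u| * `|recenter phi v|) <= 2 * D1 * D2 * `|z|.
  apply: (@le_trans _ _ (2 / `|z| * (D1 * `|z| * (D2 * `|z|)))).
    by rewrite !ler_pM // mulr_ge0.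
  rewrite le_eqVlt; apply/orP; left; apply/eqP; field.
  by rewrite normr_eq0.
have zuv2 : `|zeta| * (`|recenter phi u| * `|recenter phi v|) <= 2^-1.
  apply: le_trans zuv _; near: z; apply: near0_mul_le => //.
  by apply: mulr_ge0 => //; apply: mulr_ge0.
have b1 : `|zeta *: bmul (recenter phi u) (recenter phi v)| <= 2^-1.
  by rewrite normrZ; apply: le_trans zuv2; rewrite ler_wpM2l // bnormM.
have b2 : `|zeta *: bmul (recenter phi v) (recenter phi u)| <= 2^-1.
  rewrite normrZ; apply: le_trans zuv2; rewrite ler_wpM2l //.
  by rewrite [leRHS]mulrC bnormM.
have [N rN _] := resolvent_exists hK b1.
have [Nt rNt _] := resolvent_exists hK b2.
pose s := Xf (c e) z * Xf (c (~~ e)) z * (1 + z) / z.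
have s_le : `|s| <= 2 * C1 * C2 * `|z|.
  rewrite /s !normrM normfV ler_pdivrMr //.
  rewrite [leRHS](_ : _ = C1 * `|z| * (C2 * `|z|) * 2); last by ring.
  by rewrite !ler_pM // mulr_ge0.
have sd : `|s *: d| <= 2^-1.
  rewrite normrZ; apply: (@le_trans _ _ (`|d| * (2 * C1 * C2) * `|z|)).
    by rewrite mulrC -mulrA ler_wpM2l.
  by near: z; apply: near0_mul_le; rewrite ?mulr_ge0.
have rs : resolvent (s *: d) ((1 + z)^-1 *: bmul (bmul v N) u).
  have [rho rrho _] := resolvent_exists hK sd.
  by rewrite -(resolvent_uniq rrho (haagerup z0 al0 cu cv phiu phiv rN)).
(* The candidate [s] is small and [psi] takes the value [z] at it, so the local left inverse returns
   it. *)
have Xs : Xf d z = s.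
  have ps : psi_fun phi d s = z.
    rewrite (psi_funE hK phi_bd rs sd) linearZ /=.
    rewrite (phi_factors (alg_resolvent hK cu small1) (alg_resolvent hK cv small2) rN b1 rNt b2).
    by rewrite phiu phiv mulrA mulVf // mul1r addrC addKr.
  rewrite -{1}ps invd //; apply: le_lt_trans s_le _.
  apply: (@le_lt_trans _ _ (r / 2)); last by rewrite ltr_pdivrMr // ltr_pMr // ltr1n.
  by near: z; apply: near0_mul_le; rewrite ?mulr_ge0 // divr_gt0.
exists u, v, N, Nt; split=> //.
  split=> //; apply: le_trans (ler_wpM2l M0 zuv) _; rewrite mulrA.
  by near: z; apply: near0_mul_le => //; do 3 apply: mulr_ge0 => //.
have dP : resolvent (Xf d z *: d) ((1 + z)^-1 *: bmul (bmul v N) u) /\ `|Xf d z *: d| <= 2^-1.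
  by rewrite Xs.
exact: dP.
Unshelve. all: by end_near.
Qed.

End OneSide.

Lemma Sop_scalar (K : fieldType) (z w p : K) :
  z != 0 -> w != 0 -> 1 + z != 0 -> 1 + w != 0 ->
  w * (z + 1) / (z * (w + 1)) *
    (((1 + z) * (1 + w) + p - (w + 1)) / ((1 + z) * (1 + w) + p - (z + 1))) =
  (1 + p / (z * (1 + w))) / (1 + p / (w * (1 + z))).
Proof.
move=> z0 w0 al0 be0.
have -> : (1 + z) * (1 + w) + p - (w + 1) = z * (1 + w) * (1 + p / (z * (1 + w))).
  by field; rewrite z0 be0.
have -> : (1 + z) * (1 + w) + p - (z + 1) = w * (1 + z) * (1 + p / (w * (1 + z))).
  by field; rewrite w0 al0.
rewrite [z + 1]addrC [w + 1]addrC; set s := 1 + p / (z * _); set t := 1 + p / (w * _).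
(* Treating [t^-1] as an atom makes the identity hold also for [t = 0], where [0^-1 = 0]. *)
rewrite [(w * (1 + z) * t)^-1]invfM; move: s t^-1 => s t'.
by field; rewrite z0 w0 al0 be0.
Qed.

(** * Multiplicativity of the S-transform *)

Section Multiplicativity.
Variables (K : numFieldType) (hK : halving K) (A : banachAlgType K) (phi : {scalar A}).
Hypotheses (phi_bd : bounded_functional phi) (phi1 : phi bone = 1).
Variables (a1 b1 a2 b2 : A).
Hypothesis bf : bifree phi a1 b1 a2 b2.
Hypotheses (a1_neq0 : phi a1 != 0) (b1_neq0 : phi b1 != 0).
Hypotheses (a2_neq0 : phi a2 != 0) (b2_neq0 : phi b2 != 0).

Let a (e : bool) : A := if e then a2 else a1.
Let b (e : bool) : A := if e then b2 else b1.

Let bf' : bifree phi (a false) (b false) (a true) (b true) := bf.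

Lemma phi_bmul_recenter (x y : A) :
  phi (bmul x y) = phi x * phi y + phi (bmul (recenter phi x) (recenter phi y)).
Proof.
rewrite /recenter bmulBl !bmulBr -!bscalerAl -!bscalerAr !bmul1r !bmulr1.
by rewrite !raddfB /= !linearZ /= phi1 -![_ *: _]/(_ * _); ring.
Qed.

Lemma Sop_multiplicative : exists P Q : K -> Prop,
  [/\ \forall z \near (0 : K), P z, \forall w \near (0 : K), Q w &
   forall z w, P z -> Q w -> z != 0 -> w != 0 ->
    Sop phi (bmul a1 a2) (bmul b2 b1) z w = Sop phi a1 b1 z w * Sop phi a2 b2 z w].
Proof.
have [M M0 phiM] := phi_bd.2.
have aneq e : phi (a e) != 0 by case: e.
have bneq e : phi (b e) != 0 by case: e.
(* The colour [false] on the left gives the product [a1 a2], the colour [true] on the right gives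
   [b2 b1]; accordingly [u, v] belong to [a1, a2] and [u', v'] to [b2, b1]. *)
exists (fun z => z != 0 -> exists u v N Nt, factors phi a false M z u v N Nt).
exists (fun w => w != 0 -> exists u v N Nt, factors phi b true M w u v N Nt).
split.
- apply: factors_exist => // e X x; exact: (phi_freel phi_bd phi1 bf').
- apply: factors_exist => // e X x; exact: (phi_freer phi_bd phi1 bf').
move=> z w Pz Qw z0 w0.
have [u [v [N [Nt [al0 [ru bu pu] [rv bv pv] [rN bN rNt bNt zM] [rA bA]]]]]] := Pz z0.
have [u' [v' [N' [Nt' [be0 [ru' bu' pu'] [rv' bv' pv'] [rN' bN' rNt' bNt' wM] [rB bB]]]]]] := Qw w0.
pose x (e : bool) := if e then v else u.
pose y (e : bool) := if e then u' else v'.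
have ax e : alg a e (x e).
  by case: e; [exact: (alg_resolvent hK rv bv) | exact: (alg_resolvent hK ru bu)].
have byy e : alg b e (y e).
  by case: e; [exact: (alg_resolvent hK ru' bu') | exact: (alg_resolvent hK rv' bv')].
pose p := phi (bmul (recenter phi u) (recenter phi v')).
pose q := phi (bmul (recenter phi v) (recenter phi u')).
pose zeta := (z * (1 + z))^-1; pose om := (w * (1 + w))^-1.
(* The clauses with [M] on the two sides multiply to the bound 1/4 for its norm. *)
have det : zeta * om * (p * q) != 1.
  have pb : `|p| <= M * (`|recenter phi u| * `|recenter phi v'|).
    by apply: le_trans (phiM _) _; rewrite ler_wpM2l // bnormM.
  have qb : `|q| <= M * (`|recenter phi v| * `|recenter phi u'|).
    by apply: le_trans (phiM _) _; rewrite ler_wpM2l // bnormM.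
  apply/eqP => E; have : `|zeta * om * (p * q)| <= 2^-1 * 2^-1.
    rewrite !normrM; apply: le_trans (ler_pM _ _ zM wM) => //; try by rewrite !mulr_ge0.
    apply: (@le_trans _ _ (`|zeta| * `|om| * (M * (`|recenter phi u| * `|recenter phi v'|) *
      (M * (`|recenter phi v| * `|recenter phi u'|))))).
      by rewrite ler_wpM2l ?mulr_ge0 // ler_pM.
    by rewrite le_eqVlt /zeta /om; apply/orP; left; apply/eqP; ring.
  by rewrite E normr1 -invfM -natrM invf_ge1 // lern1.
have := pairing_value hK phi_bd phi1 bf' ax byy rN bN rNt bNt rN' bN' rNt' bNt' pv pu pu' pv' det.
rewrite -/p -/q -/zeta -/om => HE.
have H1 : H_fun phi a1 b1 (X_fun phi a1 z) (X_fun phi b1 w) = (1 + z) * (1 + w) + p.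
  by rewrite (H_funE hK phi_bd ru bu rv' bv') phi_bmul_recenter pu pv'.
have H2 : H_fun phi a2 b2 (X_fun phi a2 z) (X_fun phi b2 w) = (1 + z) * (1 + w) + q.
  by rewrite (H_funE hK phi_bd rv bv ru' bu') phi_bmul_recenter pv pu'.
pose r := (p + q + p * q * ((z * (1 + w))^-1 + (w * (1 + z))^-1)) / (1 - zeta * om * (p * q)).
have det0 : 1 - zeta * om * (p * q) != 0 by rewrite subr_eq0 eq_sym.
have H12 : H_fun phi (bmul a1 a2) (bmul b2 b1) (X_fun phi (bmul a1 a2) z) (X_fun phi (bmul b2 b1) w) =
    (1 + z) * (1 + w) + r.
  rewrite (H_funE hK phi_bd rA bA rB bB) -bscalerAl -bscalerAr !linearZ /= HE /r.
  move: det0; rewrite /zeta /om; move: (1 - _) => D D0.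
  by field; rewrite z0 w0 al0 be0 D0.
rewrite /Sop H1 H2 H12 !Sop_scalar //.
(* Since [r] depends on the two reciprocals only through their sum and product, [1 + r * s] factors
   for either of them. The common denominator cancels in the quotient that forms [Sop]. *)
have split_r s t : s * t = zeta * om -> s + t = (z * (1 + w))^-1 + (w * (1 + z))^-1 ->
    1 + r * s = (1 + p * s) * (1 + q * s) / (1 - zeta * om * (p * q)).
  by move=> st sDt; move: det0; rewrite /r -sDt -st => D0; field.
rewrite (split_r _ (w * (1 + z))^-1) //; last by rewrite /zeta /om -!invfM; congr (_^-1); ring.
rewrite (split_r _ (z * (1 + w))^-1); last by rewrite addrC.
  by rewrite invf_div mulrA mulfVK // mulf_div.
by rewrite /zeta /om -!invfM; congr (_^-1); ring.
Qed.

End Multiplicativity.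

Lemma continuous_bounded_functional (K : numFieldType) (A : banachAlgType K) (phi : {scalar A}) :
  continuous (phi : A -> K^o) -> bounded_functional phi.
Proof.
move=> phi_cont; split=> [k x y|]; first by rewrite linearD linearZ.
have : \forall x \near (0 : A), `|phi x| < 1.
  have /cvgrPdist_lt/(_ 1 ltr01) := phi_cont 0.
  by apply: filterS => x /=; rewrite linear0 sub0r normrN.
move=> /nbhs_ballP[d /= d0 dphi]; exists (2 / d); first by rewrite divr_ge0 // ltW.
move=> x; have [->|x0] := eqVneq x 0; first by rewrite linear0 !normr0 mulr0.
have nx : 0 < `|x| by rewrite normr_gt0.
have k0 : 0 < d / (2 * `|x|) by rewrite divr_gt0 // mulr_gt0.
have := dphi ((d / (2 * `|x|)) *: x); rewrite -ball_normE /= sub0r normrN normrZ gtr0_norm //.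
rewrite linearZ /= normrM gtr0_norm // => H.
have {}H : d / (2 * `|x|) * `|phi x| < 1.
  apply: H; rewrite [ltLHS](_ : _ = d / 2); first by rewrite ltr_pdivrMr // ltr_pMr // ltr1n.
  by field; rewrite gt_eqF.
have -> : 2 / d * `|x| = (d / (2 * `|x|))^-1 by field; rewrite !gt_eqF.
by rewrite -[leRHS]mulr1 mulrC -ler_pdivrMr ?invr_gt0 // invrK mulrC ltW.
Qed.

Unset Implicit Arguments.

Local Open Scope complex_scope.

Theorem theorem2p9 (R : realType) (A : banachAlgType R[i]) (phi : {scalar A})
    (phi_cont : continuous (phi : A -> R[i]^o)) (phi1 : phi bone = 1)
    (a1 b1 a2 b2 : A) :
  bifree phi a1 b1 a2 b2 ->
  phi a1 != 0 -> phi b1 != 0 -> phi a2 != 0 -> phi b2 != 0 ->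
  \forall z \near (0 : R[i]^o) & w \near (0 : R[i]^o),
    z != 0 -> w != 0 ->
    Sop phi (bmul a1 a2) (bmul b2 b1) z w = Sop phi a1 b1 z w * Sop phi a2 b2 z w.
Proof.
move=> bf a1_neq0 b1_neq0 a2_neq0 b2_neq0.
have phi_bd := continuous_bounded_functional phi_cont.
have [P [Q [nearP nearQ PQ]]] :=
  Sop_multiplicative (@halving_complex R) phi_bd phi1 bf a1_neq0 b1_neq0 a2_neq0 b2_neq0.
by exists (P, Q) => //= -[z w] [Pz Qw] z0 w0; apply: PQ.
Qed.
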